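(* Let $n\geq 2$. Every distinguished set in the polydisc $\mathbb D^n$ has complex dimension $1$.
   Context: $\mathbb D$ is the open unit disc and $\mathbb T$ the unit circle in $\mathbb C$. An algebraic set in $\mathbb C^n$ is the common zero set of some subset of $\mathbb C[z_1,\dots,z_n]$. A distinguished set in $\mathbb D^n$ is a set $\Omega=W\cap\mathbb D^n$, where $W\subset\mathbb C^n$ is an algebraic set of complex dimension greater than zero which intersects $\mathbb D^n$ and exits $\mathbb D^n$ only through the torus $\mathbb T^n$, i.e. $W\cap\partial\mathbb D^n=W\cap\mathbb T^n$, where $\partial\mathbb D^n=\overline{\mathbb D^n}\setminus\mathbb D^n$.
   Formalization: ''W of positive dimension which intersects the polydisc'' is read as: some irreducible component of W has positive dimension and meets the polydisc; read literally the claim fails, e.g. for W = {0} ∪ {z_1 = 5}, where W ∩ D^n = {0} has dimension 0. *)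

(* Defs.v *)
From HB Require Import structures.
From mathcomp Require Import all_boot all_order all_algebra.
From mathcomp Require Import all_classical all_reals all_analysis.
From mathcomp Require Import complex.
From mathcomp Require mpoly.

Set Implicit Arguments.
Unset Strict Implicit.
Unset Printing Implicit Defensive.

Import Order.TTheory GRing.Theory Num.Theory.
Import numFieldNormedType.Exports.
Local Open Scope classical_set_scope.
Local Open Scope ring_scope.

(* R[i] seen as a numClosedFieldType: the topology and the normed module
   structure of 'rV[Cplx R]_n are inferred from the number-field structure of
   the scalars, not from the bare type R[i].  The norm `|z| is Cplx R-valued;
   since it is real, `|z| < 1 and `|z| = 1 have their usual meaning. *)
Definition Cplx (R : realType) : numClosedFieldType := R[i].

Section Polydisc.
Variables (R : realType) (n : nat).
Local Notation Cn := 'rV[Cplx R]_n.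

Definition polydisc : set Cn := [set z : Cn | forall i, `|z 0 i| < 1].

Definition torus : set Cn := [set z : Cn | forall i, `|z 0 i| = 1].

Definition bd_polydisc : set Cn := closure polydisc `\` polydisc.

End Polydisc.

Section AlgebraicSets.
Variables (R : realType) (n : nat).
Local Notation Cn := 'rV[Cplx R]_n.

Definition zero_locus (P : set (mpoly.mpoly n (Cplx R))) : set Cn :=
  [set z : Cn | forall p, P p -> mpoly.meval (fun i => z 0 i) p = 0].

Definition algebraic (W : set Cn) : Prop := exists P, W = zero_locus P.

Definition irreducible_algebraic (V : set Cn) : Prop :=
  [/\ algebraic V, V !=set0 &
      forall A B : set Cn, algebraic A -> algebraic B ->
        V = A `|` B -> V = A \/ V = B].

Definition irreducible_component (V W : set Cn) : Prop :=
  [/\ irreducible_algebraic V, V `<=` W &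
      forall V' : set Cn, irreducible_algebraic V' ->
        V `<=` V' -> V' `<=` W -> V' = V].

End AlgebraicSets.

Section ComplexDimension.
Variables (R : realType).
Local Notation C := (Cplx R).

(* [differentiable] is Frechet differentiability over the scalar field, here
   C, so this is holomorphy. *)
Definition holomorphic_on (n m : nat) (U : set 'rV[C]_n)
    (f : 'rV[C]_n -> 'rV[C]_m) : Prop :=
  open U /\ forall z, U z -> differentiable f z.

(* f is a biholomorphic map of U onto V, with inverse g. *)
Definition biholomorphic (n : nat) (U V : set 'rV[C]_n)
    (f g : 'rV[C]_n -> 'rV[C]_n) : Prop :=
  [/\ holomorphic_on U f, holomorphic_on V g, f @` U = V &
      forall z, U z -> g (f z) = z].

(* M is an (embedded) complex submanifold of C^n of dimension d: around each
   of its points there are holomorphic coordinates of C^n in which M becomes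
   the coordinate subspace C^d x {0}. *)
Definition complex_submanifold (n d : nat) (M : set 'rV[C]_n) : Prop :=
  (d <= n)%N /\
  forall p, M p -> exists U V f g,
    [/\ U p, biholomorphic U V f g &
        forall z, U z ->
          (M z <-> forall i : 'I_n, (d <= i)%N -> f z 0 i = 0)].

(* The complex dimension of a subset of C^n: the largest dimension of a
   nonempty complex submanifold of C^n contained in it (Lojasiewicz).  For an
   analytic set this is the maximum of its dimensions at its regular points.
   The empty set gets the value 0. *)
Definition cdim (n : nat) (S : set 'rV[C]_n) : nat :=
  \max_(d < n.+1 | `[< exists M : set 'rV[C]_n,
          [/\ complex_submanifold d M, M !=set0 & M `<=` S] >]) d.

End ComplexDimension.

(* "W has positive dimension and meets the polydisc" is read on the
   irreducible components of W: one of them does both.  For irreducible W this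
   is 0 < cdim W and W `&` polydisc !=set0.  Asking for these two conditions
   separately of a reducible W would allow an isolated point of W to be its
   only point in the polydisc: for W = {0} `|` {z_0 = 5} one has
   W `&` bd_polydisc = W `&` torus = set0 and W `&` polydisc = {0}. *)
Definition distinguished (R : realType) (n : nat)
    (Omega : set 'rV[Cplx R]_n) : Prop :=
  exists W : set 'rV[Cplx R]_n,
    [/\ algebraic W,
        exists V : set 'rV[Cplx R]_n,
          [/\ irreducible_component V W, (0 < cdim V)%N &
              V `&` @polydisc R n !=set0],
        W `&` @bd_polydisc R n = W `&` @torus R n &
        Omega = W `&` @polydisc R n].

(* Main.v *)
Require Import Defs.
From mathcomp Require Import all_boot all_order all_algebra.
From mathcomp Require Import all_classical all_reals all_analysis.
From mathcomp Require Import complex ring.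
From mathcomp Require mpoly.

Set Implicit Arguments.
Unset Strict Implicit.
Unset Printing Implicit Defensive.

Import Order.TTheory GRing.Theory Num.Theory.
Import numFieldNormedType.Exports.
Local Open Scope ring_scope.

(** Let W be the algebraic set cutting out Omega, and fix |a| < 1.  The slice
    W `&` {z_0 = a} has no boundary point of the polydisc, so its part in the
    polydisc is compact; a compact relatively open piece of an algebraic set is
    finite.  Indeed, otherwise choose such a piece whose vanishing ideal P is
    maximal: P is prime, off a proper (hence finite) subset some coordinate t
    takes on Z(P) all values near any of its values, and the maximum of
    |t prod_s (t - s)|, s ranging over the exceptional values, is contradicted
    by moving t slightly.

    Prime ideals are analysed one variable at a time: modulo P, the variable
    z_k is either free over the previous ones or a root of a polynomial of
    minimal degree with leading coefficient outside P.  At a generic point of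
    Z(P), free variables can be moved arbitrarily with z_0 fixed, so by
    finiteness of the slices only z_0 can be free as soon as Z(P) lies in W and
    P is the ideal of a set in the polydisc.  Hence every tangent vector of a
    submanifold of Omega is determined by its z_0 component, which bounds the
    dimension by 1, and the implicit function theorem produces a curve, provided
    that Omega is infinite.

    That Omega is infinite holds because an irreducible complex algebraic set
    with an isolated point is a point.  Polynomial shears and resultants project
    the set to one lower dimension without changing the hypotheses, until it is
    a hypersurface, given by a single monic polynomial (Gauss' lemma), where the
    continuity of roots concludes. *)

(** * Iterated polynomial rings and continuity of evaluation *)

(** Iterated univariate rings, the last variable outermost: induction on n then eliminates one
    variable at a time with univariate tools. *)
Fixpoint PolT (C : idomainType) (n : nat) : idomainType :=
  if n is m.+1 then {poly PolT C m} else C.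

Section Universal.
Variables (C : idomainType) (A : comNzRingType).
Variables (a : {rmorphism C -> A}) (x : nat -> A).

(** The universal property of polynomial rings. Evaluation, shears and weighted substitutions are
    all instances, so the uniqueness statement [hom_comp] yields their compatibilities. *)
Fixpoint hom (n : nat) : {rmorphism PolT C n -> A} :=
  match n return {rmorphism PolT C n -> A} with
  | 0 => a
  | m.+1 => horner_eval (x m) \o map_poly (hom m)
  end.

Lemma homS m (p : PolT C m.+1) : hom m.+1 p = (map_poly (hom m) p).[x m].
Proof. by []. Qed.

Lemma homSC m (p : PolT C m) : hom m.+1 (p%:P : {poly PolT C m}) = hom m p.
Proof. by rewrite homS map_polyC hornerC. Qed.

Lemma homSX m : hom m.+1 ('X : {poly PolT C m}) = x m.
Proof. by rewrite homS map_polyX hornerX. Qed.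

Lemma homMXaddC m (p : {poly PolT C m}) (c : PolT C m) :
  hom m.+1 (p * 'X + c%:P) = hom m.+1 p * x m + hom m c.
Proof.
by rewrite !homS !rmorphD !rmorphM /= map_polyX map_polyC hornerD hornerM hornerX hornerC.
Qed.

End Universal.

Lemma hom_comp (C : idomainType) (A B : comNzRingType)
    (a : {rmorphism C -> A}) (x : nat -> A) (b : {rmorphism C -> B})
    (g : {rmorphism A -> B}) (y : nat -> B) n (p : PolT C n) :
  (forall c, g (a c) = b c) -> (forall i, (i < n)%N -> g (x i) = y i) ->
  g (hom a x n p) = hom b y n p.
Proof.
move=> gab; elim: n p => [|n IH] p gx; first exact: gab.
rewrite !homS -horner_map gx // -map_poly_comp; congr (_.[_]).
by apply: eq_map_poly => r; apply: IH => i lin; apply: gx; apply: ltnW.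
Qed.

Section Constants.
Variable C : idomainType.

Fixpoint cst (n : nat) : {rmorphism C -> PolT C n} :=
  match n return {rmorphism C -> PolT C n} with
  | 0 => idfun
  | m.+1 => (polyC : {rmorphism PolT C m -> {poly PolT C m}}) \o cst m
  end.

Fixpoint var (n i : nat) : PolT C n :=
  match n return PolT C n with
  | 0 => 0
  | m.+1 => (if (i == m)%N then 'X else (var m i)%:P : {poly PolT C m})
  end.

(* Points are functions nat -> C of which only the first n values matter. *)
Definition ev n (z : nat -> C) : {rmorphism PolT C n -> C} := hom idfun z n.

Lemma evS n z (p : PolT C n.+1) : ev n.+1 z p = (map_poly (ev n z) p).[z n].
Proof. by []. Qed.

Lemma evC n z (c : PolT C n) : ev n.+1 z (c%:P : {poly PolT C n}) = ev n z c.
Proof. exact: homSC. Qed.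

Lemma evX n z : ev n.+1 z ('X : {poly PolT C n}) = z n.
Proof. exact: homSX. Qed.

Lemma evMXaddC n z (p : {poly PolT C n}) (c : PolT C n) :
  ev n.+1 z (p * 'X + c%:P) = ev n.+1 z p * z n + ev n z c.
Proof. exact: homMXaddC. Qed.

Lemma hom_cst (A : comNzRingType) (a : {rmorphism C -> A}) x n c :
  hom a x n (cst n c) = a c.
Proof. by elim: n => [|n IH] //; rewrite homSC. Qed.

Lemma ev_cst n z c : ev n z (cst n c) = c. Proof. exact: hom_cst. Qed.

Lemma hom_var (A : comNzRingType) (a : {rmorphism C -> A}) x n i :
  (i < n)%N -> hom a x n (var n i) = x i.
Proof.
elim: n => [|n IH] // lin; rewrite [var _ _]/=.
case: eqP => [->|/eqP nin]; first exact: homSX.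
by rewrite homSC IH // ltn_neqAle nin.
Qed.

Lemma ev_var n z i : (i < n)%N -> ev n z (var n i) = z i.
Proof. exact: hom_var. Qed.

Lemma ev_ext n (z z' : nat -> C) p :
  (forall i, (i < n)%N -> z i = z' i) -> ev n z p = ev n z' p.
Proof. by move=> zz'; apply: (hom_comp (g := idfun)). Qed.

Lemma ev_hom m n (x : nat -> PolT C m) (p : PolT C n) z :
  ev m z (hom (cst m) x n p) = ev n (fun i => ev m z (x i)) p.
Proof. by apply: hom_comp => // c; rewrite ev_cst. Qed.

Definition upd (z : nat -> C) n t := fun i => if i == n then t else z i.

Lemma updE z n t : upd z n t n = t. Proof. by rewrite /upd eqxx. Qed.

Lemma upd_lt z n t i : (i < n)%N -> upd z n t i = z i.
Proof. by move=> lin; rewrite /upd ltn_eqF. Qed.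

Lemma ev_upd n z t p : ev n (upd z n t) p = ev n z p.
Proof. by apply: ev_ext => i; apply: upd_lt. Qed.

Lemma map_ev_upd n z t (p : PolT C n.+1) :
  map_poly (ev n (upd z n t)) p = map_poly (ev n z) p.
Proof. by apply: eq_map_poly => r; apply: ev_upd. Qed.

Lemma evS_upd n z t (p : PolT C n.+1) :
  ev n.+1 (upd z n t) p = (map_poly (ev n z) p).[t].
Proof. by rewrite evS updE map_ev_upd. Qed.

End Constants.

Lemma poly_fun0 (C : numDomainType) (p : {poly C}) :
  (forall t, p.[t] = 0) -> p = 0.
Proof.
move=> p0; apply/eqP; apply: contraT => pn0.
pose s : seq C := [seq i%:R | i <- iota 0 (size p)].
have := @max_poly_roots C p s pn0.
rewrite size_map size_iota ltnn; apply.
  by apply/allP => t _; apply/rootP.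
by rewrite map_inj_uniq ?iota_uniq //; apply: mulrIn; apply: oner_neq0.
Qed.

Lemma ev_inj0 (C : numFieldType) n (p : PolT C n) :
  (forall z, ev n z p = 0) -> p = 0.
Proof.
elim: n p => [|n IH] p p0; first exact: (p0 (fun=> 0)).
apply/polyP => i; rewrite coef0; apply: IH => z.
have /polyP/(_ i) : map_poly (ev n z) p = 0.
  by apply: poly_fun0 => t; rewrite -evS_upd.
by rewrite coef_map coef0.
Qed.

Section Continuity.
Variable C : numFieldType.
Implicit Types (z : nat -> C).

(** Only the first n coordinates are constrained; the radius lives in C, where being positive
    entails being real. *)
Definition nearby n z (Q : (nat -> C) -> Prop) :=
  exists2 d : C, 0 < d & forall z', (forall i, (i < n)%N -> `|z' i - z i| < d) -> Q z'.

Lemma pos_min (a b : C) : 0 < a -> 0 < b -> exists c, [/\ 0 < c, c <= a & c <= b].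
Proof.
move=> a0 b0; have := real_leVge (gtr0_real a0) (gtr0_real b0).
by case/orP => ?; [exists a|exists b].
Qed.

Lemma nearI n z (P Q : (nat -> C) -> Prop) :
  nearby n z P -> nearby n z Q -> nearby n z (fun z' => P z' /\ Q z').
Proof.
move=> [a a0 aP] [b b0 bP]; have [c [c0 ca cb]] := pos_min a0 b0.
exists c => // z' zz'; split; [apply: aP|apply: bP] => i lin;
 by apply: lt_le_trans (zz' i lin) _.
Qed.

Lemma nearW n z (P Q : (nat -> C) -> Prop) :
  nearby n z P -> (forall z', P z' -> Q z') -> nearby n z Q.
Proof. by move=> [a a0 aP] PQ; exists a => // z' /aP/PQ. Qed.

Lemma near_all n z : nearby n z (fun=> True).
Proof. by exists 1. Qed.

Lemma near_forall n z k (P : nat -> (nat -> C) -> Prop) :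
  (forall i, (i < k)%N -> nearby n z (P i)) ->
  nearby n z (fun z' => forall i, (i < k)%N -> P i z').
Proof.
elim: k => [|k IH] nP; first by exists 1.
have := nearI (nP k (ltnSn k)) (IH (fun i ik => nP i (ltnW ik))).
move/nearW; apply=> z' [Pk Pi] i; rewrite ltnS leq_eqVlt.
by case/orP => [/eqP -> //|]; apply: Pi.
Qed.

Lemma near_ball n z e : 0 < e ->
  nearby n z (fun z' => forall i, (i < n)%N -> `|z' i - z i| < e).
Proof. by exists e. Qed.

Definition cont n (f : (nat -> C) -> C) z :=
  forall e : C, 0 < e -> nearby n z (fun z' => `|f z' - f z| < e).

Lemma cont_cst n c z : cont n (fun=> c) z.
Proof. by move=> e e0; exists 1 => // z' _; rewrite subrr normr0. Qed.

Lemma cont_proj n i z : (i < n)%N -> cont n (fun z => z i) z.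
Proof. by move=> lin e e0; exists e => // z'; apply. Qed.

Lemma contD n f g z : cont n f z -> cont n g z -> cont n (fun z => f z + g z) z.
Proof.
move=> cf cg e e0; have e2 : 0 < e / 2%:R by rewrite divr_gt0.
apply: nearW (nearI (cf _ e2) (cg _ e2)) _ => z' [h1 h2].
rewrite opprD addrACA (le_lt_trans (ler_normD _ _)) //.
by rewrite [e]splitr ltrD.
Qed.

Lemma contM n f g z : cont n f z -> cont n g z -> cont n (fun z => f z * g z) z.
Proof.
move=> cf cg e e0; have e2 : 0 < e / 2%:R by rewrite divr_gt0.
pose m := `|f z| + `|g z| + 1.
have m0 : 0 < m by rewrite ltr_wpDl ?addr_ge0.
have [d [d0 d1 dm]] := @pos_min 1 (e / 2%:R / m) ltr01 (divr_gt0 e2 m0).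
apply: nearW (nearI (cf _ d0) (cg _ d0)) _ => z' [h1 h2].
have -> : f z' * g z' - f z * g z =
   (f z' - f z) * g z' + f z * (g z' - g z).
  by rewrite mulrBl mulrBr addrA subrK.
have gz' : `|g z'| <= `|g z| + 1.
  have -> : g z' = g z + (g z' - g z) by rewrite addrC subrK.
  rewrite (le_trans (ler_normD _ _)) // lerD2l; apply: ltW.
  exact: lt_le_trans h2 d1.
apply: le_lt_trans (ler_normD _ _) _; rewrite !normrM [e]splitr.
apply: (@le_lt_trans _ _ (`|f z' - f z| * m + m * `|g z' - g z|)).
  apply: lerD; [apply: ler_wpM2l => //|apply: ler_wpM2r => //].
    by rewrite (le_trans gz') // /m -addrA lerDr.
  by rewrite /m -addrA lerDl addr_ge0.
rewrite [m * _]mulrC.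
by apply: ltrD; rewrite -ltr_pdivlMr //; [exact: lt_le_trans h1 dm|exact: lt_le_trans h2 dm].
Qed.

Lemma cont_ev n k (F : (nat -> C) -> nat -> C) z (p : PolT C k) :
  (forall i, (i < k)%N -> cont n (fun z => F z i) z) ->
  cont n (fun z => ev k (F z) p) z.
Proof.
elim: k p => [|k IH] p cF; first exact: cont_cst.
have cF' i : (i < k)%N -> cont n (fun z => F z i) z.
  by move=> /ltnW ik; apply: cF.
elim/poly_ind: p => [|p c IHp].
  by move=> e e0; apply: nearW (near_all n z) _ => z' _; rewrite !rmorph0 subrr normr0.
move=> e e0.
have := contD (contM IHp (cF k (ltnSn k))) (IH c cF') e0.
by move/nearW; apply=> z' h; rewrite !evMXaddC.
Qed.

Lemma near_comp n k (F : (nat -> C) -> nat -> C) z (Q : (nat -> C) -> Prop) :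
  (forall i, (i < k)%N -> cont n (fun z => F z i) z) ->
  nearby k (F z) Q -> nearby n z (fun z' => Q (F z')).
Proof.
move=> cF [d d0 dQ]; have := near_forall (fun i ik => cF i ik d d0).
by move/nearW; apply=> z' h; apply: dQ.
Qed.

Lemma near_ev_neq0 k z (p : PolT C k) :
  ev k z p != 0 -> nearby k z (fun z' => ev k z' p != 0).
Proof.
move=> pn0; have := cont_ev (F := fun z => z) p (fun i ik => cont_proj z ik).
have n0 : 0 < `|ev k z p| by rewrite normr_gt0.
move=> /(_ _ n0)/nearW; apply=> z'; apply: contraTneq => ->.
by rewrite sub0r normrN ltxx.
Qed.

End Continuity.

(** * Ideals and the Hilbert basis theorem *)

Section Ideals.
Variable R : comNzRingType.
Implicit Types (I J P : R -> Prop).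

Definition ideal I :=
  [/\ I 0, forall x y, I x -> I y -> I (x + y) & forall a x, I x -> I (a * x)].

Definition prime_ideal P :=
  [/\ ideal P, ~ P 1 & forall x y, P (x * y) -> P x \/ P y].

(** Generation is stated through the ideals containing the generators, which avoids writing linear
    combinations. *)
Definition fin_gen I := exists s : seq R,
  (forall y, y \in s -> I y) /\
  forall J, ideal J -> (forall y, y \in s -> J y) -> forall x, I x -> J x.

Definition noetherian := forall I, ideal I -> fin_gen I.

Lemma ideal0 I : ideal I -> I 0. Proof. by case. Qed.
Lemma idealD I x y : ideal I -> I x -> I y -> I (x + y).
Proof. by case=> _ h _; apply: h. Qed.
Lemma idealMl I a x : ideal I -> I x -> I (a * x).
Proof. by case=> _ _; apply. Qed.
Lemma idealMr I a x : ideal I -> I x -> I (x * a).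
Proof. by rewrite mulrC; apply: idealMl. Qed.
Lemma idealN I x : ideal I -> I x -> I (- x).
Proof. by move=> iI Ix; rewrite -mulN1r; apply: idealMl. Qed.
Lemma idealB I x y : ideal I -> I x -> I y -> I (x - y).
Proof. by move=> iI Ix Iy; apply: idealD => //; apply: idealN. Qed.
Lemma idealBl I x y : ideal I -> I (x - y) -> I y -> I x.
Proof. by move=> iI Ixy Iy; rewrite -(subrK y x); apply: idealD. Qed.
Lemma ideal_sum I (T : Type) (r : seq T) (F : T -> R) :
  ideal I -> (forall i, I (F i)) -> I (\sum_(i <- r) F i).
Proof.
move=> iI IF; elim/big_ind: _ => //; first exact: ideal0.
by move=> x y; apply: idealD.
Qed.

Lemma prime_ideal_ideal P : prime_ideal P -> ideal P. Proof. by case. Qed.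

Lemma primeM P x y : prime_ideal P -> ~ P x -> ~ P y -> ~ P (x * y).
Proof. by case=> _ _ h nx ny /h[]. Qed.

Lemma prime_cancel P x y : prime_ideal P -> ~ P x -> P (x * y) -> P y.
Proof. by case=> _ _ h nx /h[]. Qed.

Lemma prime_prod P (T : eqType) (r : seq T) (F : T -> R) : prime_ideal P ->
  P (\prod_(i <- r) F i) -> exists2 i, i \in r & P (F i).
Proof.
move=> pP; elim: r => [|i r IH]; first by rewrite big_nil; case: pP.
rewrite big_cons; case: (pP) => _ _ /[apply] -[Pi|/IH[j jr Pj]].
  by exists i; rewrite ?mem_head.
by exists j; rewrite // in_cons jr orbT.
Qed.

Lemma ideal_chain (u : nat -> R -> Prop) :
  (forall k, ideal (u k)) -> (forall k x, u k x -> u k.+1 x) ->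
  ideal (fun x => exists k, u k x) /\
  forall s : seq R, (forall y, y \in s -> exists k, u k y) ->
    exists N, forall y, y \in s -> u N y.
Proof.
move=> iu uS.
have ule k l x : (k <= l)%N -> u k x -> u l x.
  by move/subnK <-; elim: (l - k)%N => // m IH /IH; apply: uS.
split; first split.
- by exists 0%N; apply: ideal0.
- move=> x y [k ux] [l uy]; exists (maxn k l); apply: idealD => //.
    by apply: ule ux; apply: leq_maxl.
  by apply: ule uy; apply: leq_maxr.
- by move=> a x [k ux]; exists k; apply: idealMl.
elim=> [|x s IH] h; first by exists 0%N.
have [k ux] := h x (mem_head _ _).
have [y ys|N uN] := IH; first by apply: h; rewrite in_cons ys orbT.
exists (maxn k N) => y; rewrite in_cons => /orP[/eqP ->|ys].
  by apply: ule ux; apply: leq_maxl.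
by apply: ule (uN _ ys); apply: leq_maxr.
Qed.

(** Without a maximal member, dependent choice builds a strictly ascending chain in F; its union is
    finitely generated, hence already contained in one of its stages. *)
Lemma noetherian_max (F : (R -> Prop) -> Prop) : noetherian ->
  (forall I, F I -> ideal I) -> (exists I, F I) ->
  exists P, F P /\ forall J, F J -> (forall x, P x -> J x) -> forall x, J x -> P x.
Proof.
move=> nR FI [I0 FI0]; apply: contrapT => noP.
have next (S : {I | F I}) : exists T : {I | F I},
    (forall x, sval S x -> sval T x) /\ exists2 x, sval T x & ~ sval S x.
  apply: contrapT => noT; apply: noP; exists (sval S); split; first exact: svalP.
  move=> J FJ SJ x Jx; apply: contrapT => nSx; apply: noT.
  by exists (exist _ J FJ); split => //; exists x.
have [nx nxP] := choice next.
pose u k := sval (iter k nx (exist _ I0 FI0)).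
have iu k : ideal (u k) by apply: FI; apply: svalP.
have uS k x : u k x -> u k.+1 x by case: (nxP (iter k nx (exist _ I0 FI0))) => + _; apply.
have [iU uN] := ideal_chain iu uS.
have [s [sU sgen]] := nR _ iU.
have [N sN] := uN s sU.
have [_ [x ux nux]] := nxP (iter N nx (exist _ I0 FI0)).
by apply: nux; apply: (sgen (u N)) => //; exists N.+1.
Qed.

End Ideals.
#[export] Hint Extern 0 (ideal _) => (apply: prime_ideal_ideal; eassumption) : core.

Lemma noetherian_field (K : fieldType) : noetherian K.
Proof.
move=> I iI; have [[x Ix xn0]|nI] := EM (exists2 x, I x & x != 0).
  exists [:: x]; split=> [y|J iJ Jx y Iy]; first by rewrite inE => /eqP ->.
  by rewrite -(mulfVK xn0 y); apply: idealMl => //; apply: Jx; rewrite mem_head.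
exists [::]; split=> // J iJ _ x Ix.
have [->|xn0] := eqVneq x 0; first exact: ideal0.
by case: nI; exists x.
Qed.

Section HilbertBasis.
Variables (R : comNzRingType) (nR : noetherian R) (I : {poly R} -> Prop).
Hypothesis iI : ideal I.

(** The coefficients in degree d of the members of I of degree at most d. These ideals increase with
    d, so their union, being finitely generated, is reached at some N. *)
Let L d a := exists f, [/\ I f, (size f <= d.+1)%N & f`_d = a].

Let L_ideal d : ideal (L d).
Proof.
split.
- by exists 0; rewrite size_poly0 coef0; split => //; apply: ideal0.
- move=> x y [f [If sf <-]] [g [Ig sg <-]]; exists (f + g); split.
  + exact: idealD.
  + by rewrite (leq_trans (size_polyD _ _)) // geq_max sf.
  + by rewrite coefD.
- move=> a x [f [If sf <-]]; exists (a%:P * f); split; first exact: idealMl.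
    by rewrite mul_polyC (leq_trans (size_scale_leq _ _)).
  by rewrite coefCM.
Qed.

Let L_S d a : L d a -> L d.+1 a.
Proof.
move=> [f [If sf <-]]; exists (f * 'X); split; first exact: idealMr.
  by rewrite (leq_trans (size_polyMleq _ _)) // size_polyX addn2.
by rewrite coefMX.
Qed.

Let L_gen d : exists G : seq {poly R},
  (forall f, f \in G -> I f /\ (size f <= d.+1)%N) /\
  forall J, ideal J -> (forall f, f \in G -> J f`_d) -> forall a, L d a -> J a.
Proof.
have [s [sL sgen]] := nR (L_ideal d).
suff [G [GI sG]] : exists G : seq {poly R},
    (forall f, f \in G -> I f /\ (size f <= d.+1)%N) /\
    forall y, y \in s -> exists2 f, f \in G & f`_d = y.
  exists G; split=> // J iJ JG; apply: sgen => // y /sG[f fG <-]; exact: JG.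
elim: s sL {sgen} => [|y s IH] sL; first by exists [::].
have [f [If sf fy]] := sL y (mem_head _ _).
have [x xs|G [GI sG]] := IH; first by apply: sL; rewrite in_cons xs orbT.
exists (f :: G); split=> [g|x]; rewrite in_cons.
  by case/orP => [/eqP ->|/GI].
case/orP => [/eqP ->|/sG[g gG <-]]; first by exists f; rewrite ?mem_head.
by exists g; rewrite // in_cons gG orbT.
Qed.

Lemma hilbert_basis_ideal : fin_gen I.
Proof.
have [iU UN] := ideal_chain L_ideal L_S.
have [s [sU sgen]] := nR iU.
have [N sN] := UN s sU.
have LN a d : L d a -> L N a.
  by move=> La; apply: (sgen (L N)) => //; exists d.
have [G GP] := choice L_gen.
exists (flatten [seq G d | d <- iota 0 N.+1]); split.
  by move=> f /flattenP[_ /mapP[d _ ->]] /(proj1 (GP d))[].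
move=> J iJ JG.
have step d a : L d a -> exists f, [/\ I f, J f, (size f <= d.+1)%N & f`_d = a].
  (* Past the stabilisation degree N, an element found in degree N is multiplied by a power of the
     variable. *)
  wlog dN : d a / (d <= N)%N => [W La|].
    have [|/ltnW Nd] := leqP d N; first by move/W; apply.
    have [f [If Jf sf fN]] := W N a (leqnn N) (LN _ _ La).
    exists (f * 'X^(d - N)); split; [exact: idealMr|exact: idealMr| |].
      rewrite (leq_trans (size_polyMleq _ _)) // size_polyXn addnS /=.
      by rewrite -[d in (_ <= d.+1)%N](subnKC Nd) -addSn leq_add2r.
    by rewrite coefMXn ltnNge leq_subr /= subKn.
  apply: (proj2 (GP d) (fun a => exists f, [/\ I f, J f, (size f <= d.+1)%N & f`_d = a])).
    split.
    - by exists 0; rewrite size_poly0 coef0; split => //; apply: ideal0.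
    - move=> x y [f [If Jf sf <-]] [g [Ig Jg sg <-]]; exists (f + g).
      split; [exact: idealD|exact: idealD| |by rewrite coefD].
      by rewrite (leq_trans (size_polyD _ _)) // geq_max sf.
    - move=> b x [f [If Jf sf <-]]; exists (b%:P * f).
      split; [exact: idealMl|exact: idealMl| |by rewrite coefCM].
      by rewrite mul_polyC (leq_trans (size_scale_leq _ _)).
  move=> f fG; have [If sf] := proj1 (GP d) f fG.
  exists f; split=> //; apply: JG; apply/flattenP; exists (G d) => //.
  by apply/mapP; exists d; rewrite // mem_iota add0n ltnS.
move=> f; have [n] := ubnP (size f); elim: n f => // n IH f.
have [->|fn0] := eqVneq f 0; first by move=> *; apply: ideal0.
rewrite ltnS => sfn If; pose d := (size f).-1.
have sf : size f = d.+1 by rewrite prednK // lt0n size_poly_eq0.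
have [g [Ig Jg sg gd]] : exists g, [/\ I g, J g, (size g <= d.+1)%N & g`_d = f`_d].
  by apply: step; exists f; rewrite sf.
apply: (idealBl iJ _ Jg); apply: IH; last exact: idealB.
apply: leq_trans sfn; rewrite sf ltnS; apply/leq_sizeP => j.
rewrite leq_eqVlt => /orP[/eqP <-|dj]; rewrite coefB ?gd ?subrr //.
by rewrite !nth_default ?subrr // ?sf // (leq_trans sg).
Qed.
End HilbertBasis.

Lemma hilbert_basis (R : comNzRingType) : noetherian R -> noetherian {poly R}.
Proof. by move=> nR I iI; apply: hilbert_basis_ideal. Qed.

Lemma noetherian_PolT (K : fieldType) n : noetherian (PolT K n).
Proof. by elim: n => [|n IH]; [apply: noetherian_field|apply: hilbert_basis]. Qed.

(** * Eliminating one variable modulo a prime ideal *)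

Section OneLevel.
Variables (R : comNzRingType) (P : {poly R} -> Prop).

Definition contract (r : R) := P r%:P.

(** P is extended from its contraction: the outer variable is transcendental modulo P. *)
Definition free_level := forall h, P h -> forall i, contract h`_i.

(** F plays the role of a minimal polynomial of the outer variable over the fraction field of the
    quotient by the contraction. *)
Definition algebraic_level F := [/\ P F, ~ contract (lead_coef F) &
  forall h, P h -> (size h < size F)%N -> forall i, contract h`_i].

Hypothesis pP : prime_ideal P.

Lemma contract_ideal : ideal contract.
Proof.
rewrite /contract; split=> [|x y Px Py|a x Px].
- rewrite polyC0. by apply: ideal0.
- rewrite polyCD; by apply: idealD.
- by rewrite polyCM; apply: idealMl.
Qed.

Hint Extern 0 (ideal contract) => exact contract_ideal : core.

Lemma contract_prime : prime_ideal contract.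
Proof.
split; first done; rewrite /contract.
  by case: pP.
by move=> x y; rewrite polyCM; case: pP => _ _; apply.
Qed.

Lemma coef_contract (h : {poly R}) : (forall i, contract h`_i) -> P h.
Proof.
move=> hc; rewrite -[h]coefK poly_def; apply: ideal_sum => // i.
by rewrite -mul_polyC; apply: idealMr => //; apply: hc.
Qed.

Lemma algebraic_level_size F : algebraic_level F -> (1 < size F)%N.
Proof.
case=> PF nl _; rewrite ltnNge; apply: contra_notN nl => /size1_polyC FE.
by rewrite /contract FE lead_coefC -FE.
Qed.

Lemma coef_contract_lead (h : {poly R}) : P h ->
  (forall g, P g -> (size g <= size h)%N -> contract (lead_coef g)) ->
  forall i, contract h`_i.
Proof.
have [n] := ubnP (size h); elim: n h => // n IH h.
rewrite ltnS => shn Ph lc.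
have [->|hn0] := eqVneq h 0; first by move=> i; rewrite coef0; apply: ideal0.
have lh : contract (lead_coef h) by apply: lc.
pose g := h - (lead_coef h)%:P * 'X^((size h).-1).
have Pg : P g by apply: idealB => //; apply: idealMr.
have sg : (size g < size h)%N.
  have sh : (size h).-1.+1 = size h by rewrite prednK // lt0n size_poly_eq0.
  rewrite -[X in (_ < X)%N]sh ltnS; apply/leq_sizeP => j.
  rewrite leq_eqVlt /g coefB coefCM coefXn => /orP[/eqP <-|hj].
    by rewrite eqxx mulr1 subrr.
  by rewrite gtn_eqF // mulr0 nth_default ?subrr // -sh.
move=> i; have -> : h`_i = g`_i + ((lead_coef h)%:P * 'X^((size h).-1))`_i.
  by rewrite -coefD subrK.
apply: idealD => //; last by rewrite coefCM; apply: idealMr.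
apply: IH => // [|f Pf sf]; first exact: leq_trans shn.
by apply: lc => //; apply: leq_trans (ltnW sg).
Qed.

Lemma one_level : free_level \/ exists F, algebraic_level F.
Proof.
have [|nfree] := EM free_level; [by left|right].
pose E k := `[< exists F, [/\ P F, ~ contract (lead_coef F) & size F = k] >].
have exE : exists k, E k.
  apply: contrapT => nE; apply: nfree => h Ph.
  apply: coef_contract_lead => // g Pg _; apply: contrapT => nl.
  by apply: nE; exists (size g); apply/asboolP; exists g.
case: (ex_minnP exE) => k /asboolP[F [PF nl <-]] kmin; exists F; split=> //.
move=> h Ph shF; apply: coef_contract_lead => // g Pg sg.
apply: contrapT => nlg; have : (size F <= size g)%N.
  by apply: kmin; apply/asboolP; exists g.
by rewrite leqNgt (leq_ltn_trans sg shF).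
Qed.

Lemma algebraic_level_div F h : algebraic_level F -> P h ->
  exists k q r, lead_coef F ^+ k *: h = q * F + r /\ forall i, contract r`_i.
Proof.
move=> [PF nl Fmin] Ph.
exists (Pdiv.CommonRing.rscalp h F), (Pdiv.CommonRing.rdivp h F),
  (Pdiv.CommonRing.rmodp h F).
have E := Pdiv.ComRing.rdivp_eq F h; split=> //; apply: Fmin.
  have -> : Pdiv.CommonRing.rmodp h F =
      lead_coef F ^+ Pdiv.CommonRing.rscalp h F *: h - Pdiv.CommonRing.rdivp h F * F.
    by rewrite E addrC addKr.
  by apply: idealB => //; [rewrite -mul_polyC|]; apply: idealMl.
rewrite Pdiv.CommonRing.ltn_rmodp; apply: contra_notN nl => /eqP ->.
by rewrite lead_coef0; apply: ideal0.
Qed.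

(** Generic separability: if F' were in P, being shorter than F it would have its coefficients in
    the contraction, among them the degree times the leading coefficient of F, and the degree is
    invertible. *)
Lemma algebraic_level_deriv F : (forall n, exists u : R, u * n.+1%:R = 1) ->
  algebraic_level F -> ~ P F^`().
Proof.
move=> char0 aF; have := algebraic_level_size aF.
case: aF => PF nl Fmin sF PF'; apply: nl.
have Fn0 : F != 0 by rewrite -size_poly_eq0 -lt0n ltnW.
have := Fmin _ PF' (lt_size_deriv Fn0) (size F).-2.
rewrite coef_deriv lead_coefE.
case: (size F) sF => [|[|m]] //= _ h.
have [u u1] := char0 m.
rewrite -[_`_ _]mul1r -u1 -mulrA mulr_natl.
by apply: idealMl => //.
Qed.

End OneLevel.

(** The modulus of p at y is that of the leading coefficient times the product of the distances from
    y to the roots, so some distance is below e. *)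
Lemma root_near (C : numClosedFieldType) (p : {poly C}) (y e : C) : 0 < e ->
  `|p.[y]| < `|lead_coef p| * e ^+ (size p).-1 ->
  exists2 t, root p t & `|t - y| < e.
Proof.
move=> e0; have [r pE] := closed_field_poly_normal p => ply.
have pn0 : lead_coef p != 0.
  apply: contraTneq ply => ->; rewrite normr0 mul0r.
  by rewrite le_gtF.
apply: contrapT => nr.
suff : `|lead_coef p| * e ^+ (size p).-1 <= `|p.[y]|.
  by move=> /(lt_le_trans ply); rewrite ltxx.
have -> : (size p).-1 = size r.
  by rewrite pE size_scale // size_prod_XsubC.
rewrite [p in X in _ <= X]pE hornerZ normrM ler_wpM2l // horner_prod normr_prod.
have rr t : t \in r -> root p t.
  by move=> tr; rewrite pE rootZ // root_prod_XsubC.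
elim: r {pE} rr => [|t r IH] rr; first by rewrite big_nil expr0.
rewrite big_cons /= exprS ler_pM ?exprn_ge0 ?(ltW e0) //; last first.
  by apply: IH => s sr; apply: rr; rewrite in_cons sr orbT.
rewrite hornerXsubC distrC real_leNgt ?normr_real ?(gtr0_real e0) //.
by apply/negP => h; apply: nr; exists t => //; apply: rr; rewrite mem_head.
Qed.

(** * Zero sets and elimination of the last variable *)

Section ZeroSets.
Variable C : numFieldType.
Implicit Types (z : nat -> C).

Definition zeros n (P : PolT C n -> Prop) z := forall h, P h -> ev n z h = 0.

Lemma zeros_ext n (P : PolT C n -> Prop) z z' :
  (forall i, (i < n)%N -> z i = z' i) -> zeros P z -> zeros P z'.
Proof. by move=> zz' Pz h /Pz <-; apply: ev_ext => i /zz'. Qed.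

Lemma zeros_contract n (P : PolT C n.+1 -> Prop) z :
  zeros P z -> zeros (contract (R := PolT C n) P) z.
Proof. by move=> Pz h /Pz; rewrite evC. Qed.

Lemma zeros_free n (P : PolT C n.+1 -> Prop) z :
  free_level (R := PolT C n) P -> zeros (contract (R := PolT C n) P) z -> zeros P z.
Proof.
move=> fP Pz h Ph; rewrite evS (_ : map_poly _ h = 0) ?horner0 //.
by apply/polyP => i; rewrite coef_map coef0; apply: Pz; apply: fP.
Qed.

Lemma zeros_algebraic n (P : PolT C n.+1 -> Prop) F z :
  prime_ideal P -> algebraic_level (R := PolT C n) P F ->
  zeros (contract (R := PolT C n) P) z -> ev n z (lead_coef F) != 0 ->
  ev n.+1 z F = 0 -> zeros P z.
Proof.
move=> pP aF Pz lz Fz h Ph.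
have [k [q [r [E rP]]]] := algebraic_level_div pP aF Ph.
have rz : ev n.+1 z r = 0.
  rewrite evS (_ : map_poly _ r = 0) ?horner0 //.
  by apply/polyP => i; rewrite coef_map coef0; apply: Pz.
have /eqP := congr1 (ev n.+1 z) E; rewrite -mul_polyC rmorphD 2!rmorphM Fz rz.
rewrite mulr0 addr0 evC rmorphXn mulf_eq0 expf_eq0 (negPf lz) andbF.
by move/eqP.
Qed.

Lemma PolT_char0 n m : exists u : PolT C n, u * m.+1%:R = 1.
Proof.
exists (cst C n m.+1%:R^-1); rewrite -(rmorph_nat (cst C n)) -rmorphM.
by rewrite mulVf ?rmorph1 // pnatr_eq0.
Qed.

End ZeroSets.

(** * Complex derivatives along curves *)

Section Derivatives.
Variable C : numFieldType.
Implicit Types (f g : C -> C) (s d : C).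

Lemma contN n (f : (nat -> C) -> C) z : cont n f z -> cont n (fun z => - f z) z.
Proof.
by move=> cf e e0; apply: nearW (cf e e0) _ => z' /=; rewrite -opprD normrN.
Qed.

Lemma contV n (f : (nat -> C) -> C) z : f z != 0 -> cont n f z ->
  cont n (fun z => (f z)^-1) z.
Proof.
move=> fz0 cf e e0; have a0 : 0 < `|f z| by rewrite normr_gt0.
pose b := `|f z| / 2%:R; have b0 : 0 < b by rewrite divr_gt0.
have eb0 : 0 < e * (b * `|f z|) by do 2 ?[apply: mulr_gt0 => //].
have [d [d0 db de]] := pos_min b0 eb0.
apply: nearW (cf d d0) _ => z' h.
have bz : b < `|f z'|.
  rewrite -(ltrD2r b) -splitr; have := lerB_dist (f z) (f z').
  rewrite lerBlDr => /le_lt_trans; apply; rewrite addrC ltrD2l distrC.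
  exact: lt_le_trans h db.
have fz'0 : f z' != 0 by rewrite -normr_gt0 (lt_trans b0).
have -> : (f z')^-1 - (f z)^-1 = (f z - f z') / (f z' * f z).
  by field; rewrite fz0 fz'0.
have ff0 : 0 < `|f z'| * `|f z| by apply: mulr_gt0 => //; apply: lt_trans bz.
rewrite normrM normfV normrM distrC ltr_pdivrMr //.
apply: (lt_le_trans h); apply: le_trans de _.
by rewrite ler_wpM2l ?(ltW e0) // ler_wpM2r // ltW.
Qed.

Definition cont1 f s := cont 1 (fun z => f (z 0%N)) (fun=> s).

(* Caratheodory's form of differentiability at s; it makes the product rule and
   the implicit function theorem statements about continuous quotients. *)
Definition hasder f s d := exists2 h : C -> C,
  (forall s', f s' - f s = (s' - s) * h s') & cont1 h s /\ h s = d.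

Lemma cont1_id s : cont1 id s. Proof. exact: cont_proj. Qed.

Lemma hasder_cont f s d : hasder f s d -> cont1 f s.
Proof.
move=> [h fE [ch _]]; rewrite /cont1.
have -> : (fun z : nat -> C => f (z 0%N)) = fun z => f s + (z 0%N - s) * h (z 0%N).
  by apply: funext => z; rewrite -fE addrC subrK.
apply: contD; first exact: cont_cst.
apply: contM => //; apply: contD; [exact: cont1_id|exact: cont_cst].
Qed.

Lemma hasder_cst c s : hasder (fun=> c) s 0.
Proof.
exists (fun=> 0) => [s'|]; first by rewrite subrr mulr0.
by split=> //; apply: cont_cst.
Qed.

Lemma hasder_id s : hasder id s 1.
Proof.
exists (fun=> 1) => [s'|]; first by rewrite mulr1.
by split=> //; apply: cont_cst.
Qed.

Lemma hasderD f g s d d' : hasder f s d -> hasder g s d' ->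
  hasder (fun s => f s + g s) s (d + d').
Proof.
move=> [h fE [ch <-]] [k gE [ck <-]]; exists (fun s => h s + k s).
  by move=> s'; rewrite mulrDr -fE -gE opprD addrACA.
by split=> //; apply: contD.
Qed.

Lemma hasderM f g s d d' : hasder f s d -> hasder g s d' ->
  hasder (fun s => f s * g s) s (d * g s + f s * d').
Proof.
move=> hf hg; have cg := hasder_cont hg.
case: hf hg => [h fE [ch <-]] [k gE [ck <-]].
exists (fun s' => h s' * g s' + f s * k s').
  move=> s'; rewrite mulrDr mulrA -fE mulrCA -gE; ring.
split=> //; apply: contD; apply: contM => //; exact: cont_cst.
Qed.

Lemma hasder0 f s d : hasder f s d ->
  (exists2 r : C, 0 < r & forall s', `|s' - s| < r -> f s' = f s) -> d = 0.
Proof.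
move=> [h fE [ch <-]] [r r0 f0]; apply/eqP; apply: contraT => hn0.
have a0 : 0 < `|h s| by rewrite normr_gt0.
have [d' d'0 dP] := ch _ a0.
have [e [e0 er ed]] := pos_min r0 d'0.
pose s' := s + e / 2%:R.
have e20 : 0 < e / 2%:R by rewrite divr_gt0.
have ss' : `|s' - s| < e.
  rewrite /s' addrC addKr gtr0_norm // [X in _ < X]splitr ltrDl //.
have := dP (fun=> s') (fun _ _ => lt_le_trans ss' ed).
have : (s' - s) * h s' = 0 by rewrite -fE f0 ?subrr // (lt_le_trans ss').
move/eqP; rewrite mulf_eq0 /s' [_ - s]addrC addKr gt_eqF //= => /eqP ->.
by rewrite sub0r normrN ltxx.
Qed.

Lemma hasder_ev n (phi : C -> nat -> C) s (d : nat -> C) (p : PolT C n) :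
  (forall i, (i < n)%N -> hasder (fun s => phi s i) s (d i)) ->
  exists d', hasder (fun s => ev n (phi s) p) s d'.
Proof.
elim: n p => [|n IH] p hphi; first by exists 0; apply: hasder_cst.
have hphi' i : (i < n)%N -> hasder (fun s => phi s i) s (d i).
  by move=> /ltnW; apply: hphi.
elim/poly_ind: p => [|p c [d1 IHp]].
  exists 0; have -> : (fun s => ev n.+1 (phi s) 0) = fun=> 0; last exact: hasder_cst.
  by apply: funext => s'; rewrite rmorph0.
have [d2 hc] := IH c hphi'.
eexists; have -> : (fun s => ev n.+1 (phi s) (p * 'X + c%:P)) =
    fun s => ev n.+1 (phi s) p * phi s n + ev n (phi s) c.
  by apply: funext => s'; rewrite evMXaddC.
by apply: hasderD hc; apply: hasderM IHp (hphi n _).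
Qed.

Lemma hasder_ev0 n (phi : C -> nat -> C) s (p : PolT C n) :
  (forall i, (i < n)%N -> hasder (fun s => phi s i) s 0) ->
  hasder (fun s => ev n (phi s) p) s 0.
Proof.
elim: n p => [|n IH] p hphi; first exact: hasder_cst.
have hphi' i : (i < n)%N -> hasder (fun s => phi s i) s 0.
  by move=> /ltnW; apply: hphi.
elim/poly_ind: p => [|p c IHp].
  have -> : (fun s => ev n.+1 (phi s) 0) = fun=> 0; last exact: hasder_cst.
  by apply: funext => s'; rewrite rmorph0.
have -> : (fun s => ev n.+1 (phi s) (p * 'X + c%:P)) =
    fun s => ev n.+1 (phi s) p * phi s n + ev n (phi s) c.
  by apply: funext => s'; rewrite evMXaddC.
have := hasderD (hasderM IHp (hphi n (ltnSn n))) (IH c hphi').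
by rewrite mul0r mulr0 !addr0.
Qed.

(** The chain rule when all coordinates but the last are stationary: only the partial derivative in
    the last variable survives. *)
Lemma hasder_ev_lead n (phi : C -> nat -> C) s d (p : {poly PolT C n}) :
  (forall i, (i < n)%N -> hasder (fun s => phi s i) s 0) ->
  hasder (fun s => phi s n) s d ->
  hasder (fun s => ev n.+1 (phi s) p) s (ev n.+1 (phi s) p^`() * d).
Proof.
move=> hphi hn; elim/poly_ind: p => [|p c IHp].
  rewrite deriv0 rmorph0 mul0r.
  have -> : (fun s => ev n.+1 (phi s) 0) = fun=> 0; last exact: hasder_cst.
  by apply: funext => s'; rewrite rmorph0.
have -> : (fun s => ev n.+1 (phi s) (p * 'X + c%:P)) =
    fun s => ev n.+1 (phi s) p * phi s n + ev n (phi s) c.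
  by apply: funext => s'; rewrite evMXaddC.
have := hasderD (hasderM IHp hn) (hasder_ev0 c hphi).
congr hasder; rewrite derivMXaddC [X in _ = X * _]rmorphD rmorphM.
rewrite evX; ring.
Qed.

(** The polynomial (F(y) - F(x)) / (y - x), with x in position n and y in position n + 1; it turns
    the implicit function theorem into the continuity of a quotient. *)
Lemma diff_quotient n (F : {poly PolT C n}) : exists G : PolT C n.+2,
  (forall z x y, ev n.+1 (upd z n y) F - ev n.+1 (upd z n x) F =
     (y - x) * ev n.+2 (upd (upd z n x) n.+1 y) G) /\
  forall z x, ev n.+2 (upd (upd z n x) n.+1 x) G = ev n.+1 (upd z n x) F^`().
Proof.
elim/poly_ind: F => [|F c [G [GE GD]]].
  by exists 0; split=> *; rewrite ?deriv0 !rmorph0 ?subrr ?mulr0.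
(* From F(y) y - F(x) x = (F(y) - F(x)) y + (y - x) F(x). *)
exists ((G : {poly {poly PolT C n}}) * 'X + F%:P); split=> [z x y|z x].
  rewrite !evMXaddC (updE z n y) (updE z n x) (updE (upd z n x) n.+1 y).
  rewrite (ev_upd z y) (ev_upd z x) (ev_upd (upd z n x) y).
  have alg (a b g e : C) : a - b = (y - x) * g ->
      a * y + e - (b * x + e) = (y - x) * (g * y + b).
    by move=> ab; rewrite (_ : a = b + (y - x) * g); [ring|rewrite -ab addrC subrK].
  exact: alg.
rewrite derivMXaddC evMXaddC (updE (upd z n x) n.+1 x) GD (ev_upd (upd z n x) x).
by rewrite [in RHS]rmorphD rmorphM evX updE addrC.
Qed.

End Derivatives.

(** * Generic local structure of zero sets of prime ideals *)

Section LocalStructure.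
Variable C : numClosedFieldType.
Implicit Types (z q : nat -> C).

Local Notation ctr P := (contract (R := PolT C _) P).

Lemma cont_upd n k (g : (nat -> C) -> C) (F : (nat -> C) -> nat -> C) z :
  (forall i, (i < k)%N -> cont n (fun z => F z i) z) -> cont n g z ->
  forall i, (i < k.+1)%N -> cont n (fun z => upd (F z) k (g z) i) z.
Proof.
move=> cF cg i; rewrite ltnS leq_eqVlt => /orP[/eqP ->|ik].
  by rewrite (_ : (fun _ => _) = g) //; apply: funext => z'; rewrite updE.
by have := cF i ik; congr cont; apply: funext => z'; rewrite upd_lt.
Qed.

(** Continuity of roots: near q the leading coefficient keeps half its modulus while the value at
    [q n] becomes as small as [root_near] requires. *)
Lemma root_lift n (F : {poly PolT C n}) q e : 0 < e ->
  ev n q (lead_coef F) != 0 -> ev n.+1 q F = 0 ->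
  nearby n q (fun z => exists2 t, ev n.+1 (upd z n t) F = 0 & `|t - q n| < e).
Proof.
move=> e0 lq Fq; pose D := (size F).-1.
pose a := `|ev n q (lead_coef F)| / 2%:R.
have a0 : 0 < a by rewrite divr_gt0 // normr_gt0.
have ae0 : 0 < a * e ^+ D by rewrite mulr_gt0 // exprn_gt0.
have cl := cont_ev (F := id) (lead_coef F) (fun i ik => cont_proj q ik).
have cF : cont n (fun z => ev n.+1 (upd z n (q n)) F) q.
  apply: cont_ev; apply: (cont_upd (F := id) (g := fun=> q n)); last exact: cont_cst.
  by move=> i; apply: cont_proj.
have Fq0 : ev n.+1 (upd q n (q n)) F = 0.
  rewrite -Fq; apply: ev_ext => i _; rewrite /upd; by case: eqP => [->|].
apply: nearW (nearI (cl _ a0) (cF _ ae0)) _ => z [].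
rewrite Fq0 subr0 evS_upd => hl hF.
have lz : a < `|ev n z (lead_coef F)|.
  rewrite -(ltrD2r a) -splitr.
  have := lerB_dist (ev n q (lead_coef F)) (ev n z (lead_coef F)).
  by rewrite lerBlDr => /le_lt_trans; apply; rewrite addrC ltrD2l distrC.
have lz0 : ev n z (lead_coef F) != 0 by rewrite -normr_gt0 (lt_trans a0).
have [|t /rootP Ft te] := @root_near _ (map_poly (ev n z) F) (q n) e e0.
  rewrite size_map_poly_id0 // lead_coef_map_id0 ?rmorph0 //.
  by apply: lt_trans hF _; rewrite ltr_pM2r // exprn_gt0.
by exists t => //; rewrite evS_upd.
Qed.

Lemma zeros_lift n (P : PolT C n.+1 -> Prop) F q e :
  prime_ideal P -> algebraic_level (R := PolT C n) P F -> 0 < e ->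
  zeros P q -> ev n q (lead_coef F) != 0 ->
  nearby n q (fun z => zeros (ctr P) z ->
     exists2 t, zeros P (upd z n t) & `|t - q n| < e).
Proof.
move=> pP aF e0 Pq lq; have [PF _ _] := aF.
have := nearI (root_lift e0 lq (Pq _ PF)) (near_ev_neq0 lq).
move/nearW; apply=> z [[t Ft te] lz] Pz; exists t => //.
apply: (zeros_algebraic pP aF); rewrite ?ev_upd //.
by apply: zeros_ext Pz => i lin; rewrite upd_lt.
Qed.

(** The coordinate z_k is free at generic points, those where c does not vanish. The coordinates
    before k stay fixed, in particular z_0 when k > 0. *)
Definition lifts_at n k (P : PolT C n -> Prop) (c : PolT C n) :=
  forall q, zeros P q -> ev n q c != 0 -> forall e : C, 0 < e ->
  exists2 d : C, 0 < d & forall t, `|t - q k| < d -> exists z,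
    [/\ zeros P z, forall i, (i < n)%N -> `|z i - q i| < e, z k = t &
        forall i, (i < k)%N -> z i = q i].

Definition point_ideal n (P : PolT C n -> Prop) :=
  exists a : nat -> C, forall r, ev n a r = 0 -> P r.

Definition curve_through n (P : PolT C n -> Prop) (c : PolT C n) :=
  forall q, zeros P q -> ev n q c != 0 -> forall e : C, 0 < e ->
  exists (r : C) (phi : C -> nat -> C), 0 < r /\ forall s, `|s - q 0%N| < r ->
    [/\ phi s 0%N = s, zeros P (phi s),
        forall i, (i < n)%N -> `|phi s i - q i| < e &
        forall i, (i < n)%N -> exists d, hasder (fun s => phi s i) s d].

(** The infinitesimal counterpart of z_0 being the only possibly free variable; it is what bounds
    the dimension of submanifolds. *)
Definition tangent_rigid n (P : PolT C n -> Prop) (c : PolT C n) :=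
  forall (phi : C -> nat -> C) (d : nat -> C) s,
    (exists2 r : C, 0 < r & forall s', `|s' - s| < r -> zeros P (phi s')) ->
    ev n (phi s) c != 0 ->
    (forall i, (i < n)%N -> hasder (fun s => phi s i) s (d i)) ->
    d 0%N = 0 -> forall i, (i < n)%N -> d i = 0.

Section Step.
Variables (n : nat) (P : PolT C n.+1 -> Prop).
Hypothesis pP : prime_ideal P.

Lemma lifts_at_free k c : (k < n)%N -> free_level (R := PolT C n) P ->
  lifts_at k (ctr P) c -> lifts_at k P (c%:P : {poly PolT C n}).
Proof.
move=> kn fP lP q Pq; rewrite evC => cq e e0.
have [d d0 dP] := lP q (zeros_contract Pq) cq e e0.
exists d => // t /dP[z [Pz zq zk zi]]; exists (upd z n (q n)); split.
- apply: zeros_free => //; apply: zeros_ext Pz => i lin; by rewrite upd_lt.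
- move=> i; rewrite ltnS leq_eqVlt => /orP[/eqP ->|lin].
    by rewrite updE subrr normr0.
  by rewrite upd_lt //; apply: zq.
- by rewrite upd_lt.
- by move=> i ik; rewrite upd_lt ?zi // (ltn_trans ik).
Qed.

Lemma lifts_at_new : free_level (R := PolT C n) P -> lifts_at n P 1.
Proof.
move=> fP q Pq _ e e0; exists e => // t te; exists (upd q n t); split.
- apply: zeros_free => //.
  by apply: zeros_ext (zeros_contract Pq) => i lin; rewrite upd_lt.
- move=> i; rewrite ltnS leq_eqVlt => /orP[/eqP ->|lin]; first by rewrite updE.
  by rewrite upd_lt // subrr normr0.
- by rewrite updE.
- by move=> i lin; rewrite upd_lt.
Qed.

Variable F : {poly PolT C n}.
Hypothesis aF : algebraic_level (R := PolT C n) P F.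

Lemma lifts_at_algebraic k c : (k < n)%N ->
  lifts_at k (ctr P) c -> lifts_at k P ((c * lead_coef F)%:P : {poly PolT C n}).
Proof.
move=> kn lP q Pq; rewrite evC rmorphM mulf_eq0 negb_or => /andP[cq lq] e e0.
have [d1 d10 d1P] := zeros_lift pP aF e0 Pq lq.
have [e1 [e10 e1e e1d]] := pos_min e0 d10.
have [d d0 dP] := lP q (zeros_contract Pq) cq e1 e10.
exists d => // t /dP[z [Pz zq zk zi]].
have [|w Pw wq] := d1P z _ Pz.
  by move=> i lin; apply: lt_le_trans (zq i lin) e1d.
exists (upd z n w); split=> //.
- move=> i; rewrite ltnS leq_eqVlt => /orP[/eqP ->|lin]; first by rewrite updE.
  by rewrite upd_lt //; apply: lt_le_trans (zq i lin) e1e.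
- by rewrite upd_lt.
- by move=> i ik; rewrite upd_lt ?zi // (ltn_trans ik).
Qed.

(** Modulo P the coefficients of F are constants, so F becomes a nonzero univariate polynomial over
    C. It splits, and P, being prime, contains one of the linear factors. *)
Lemma point_ideal_algebraic : point_ideal (ctr P) -> point_ideal P.
Proof.
move=> [a aP]; have [PF nl _] := aF.
pose L : {rmorphism {poly C} -> {poly PolT C n}} := map_poly (cst C n).
have red (h : {poly PolT C n}) : P (h - L (map_poly (ev n a) h)).
  apply: (coef_contract pP) => i; apply: aP.
  by rewrite coefB rmorphB !coef_map ev_cst subrr.
have la : ev n a (lead_coef F) != 0 by apply: contra_notN nl => /eqP; apply: aP.
pose f := map_poly (ev n a) F.
have Pf : P (L f).
  by rewrite -[L f](subKr F); apply: idealB.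
have [r fE] := closed_field_poly_normal f.
have lf : lead_coef f != 0 by rewrite lead_coef_map_id0 ?rmorph0.
have : P (L (\prod_(b <- r) ('X - b%:P))).
  have -> : \prod_(b <- r) ('X - b%:P) = (lead_coef f)^-1%:P * f.
    by rewrite mul_polyC [X in _ = _ *: X]fE scalerA mulVf // scale1r.
  by rewrite rmorphM; apply: idealMl.
rewrite rmorph_prod => /(prime_prod pP)[b br Pb].
exists (upd a n b) => h; rewrite evS_upd => /rootP/factor_theorem[g gE].
apply: (idealBl _ (red h)) => //.
by rewrite gE rmorphM; apply: idealMl.
Qed.

(** Differentiating F = 0 along the curve gives F' times the last velocity equal to 0, once the
    earlier velocities vanish. *)
Lemma tangent_rigid_algebraic c : tangent_rigid (ctr P) c ->
  tangent_rigid P (c%:P * F^`()).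
Proof.
move=> tP phi d s [r r0 rP] cs dphi d0.
have [cs' Fs] : ev n (phi s) c != 0 /\ ev n.+1 (phi s) F^`() != 0.
  by apply/andP; rewrite -negb_or -mulf_eq0 -(evC (phi s) c) -rmorphM.
have di : forall i, (i < n)%N -> d i = 0.
  apply: (tP phi d s) => // [|i lin]; last by apply: dphi; apply: ltnW.
  by exists r => // s' /rP; apply: zeros_contract.
have := @hasder_ev_lead _ _ phi s (d n) F _ (dphi n (ltnSn n)).
move=> /(_ _)/hasder0 hd; have [PF _ _] := aF.
have /eqP : ev n.+1 (phi s) F^`() * d n = 0.
  apply: hd => [i lin|]; first by rewrite -(di i lin); apply: dphi; apply: ltnW.
  by exists r => // s' /rP h; rewrite !h // rP // subrr normr0.
rewrite mulf_eq0 (negPf Fs) /= => /eqP dn i.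
by rewrite ltnS leq_eqVlt => /orP[/eqP ->|/di].
Qed.

(** The implicit function theorem. A root [chi s] near [q n] is chosen over each s with no
    regularity assumed; continuity and then differentiability follow from the factorisation through
    G, which stays away from 0 near q. Since 0 < n, z_0 is a coordinate of the base curve and
    remains the parameter. *)
Lemma curve_through_algebraic c : (0 < n)%N -> curve_through (ctr P) c ->
  curve_through P ((c * lead_coef F)%:P * F^`()).
Proof.
move=> n0 cP q Pq cq e e0; have [PF _ _] := aF.
have [cq' lq Dq] : [/\ ev n q c != 0, ev n q (lead_coef F) != 0 & ev n.+1 q F^`() != 0].
  by move: cq; rewrite rmorphM evC rmorphM !mulf_eq0 !negb_or => /andP[/andP[]].
have [G [GE GD]] := diff_quotient F.
pose q2 := upd (upd q n (q n)) n.+1 (q n).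
have Gq : ev n.+2 q2 G != 0.
  rewrite GD; apply: contra_neq Dq => <-; apply: ev_ext => i _.
  by rewrite /upd; case: eqP => [->|].
pose b := `|ev n.+2 q2 G| / 2%:R.
have b0 : 0 < b by rewrite divr_gt0 // normr_gt0.
have [rho rho0 Gb] : nearby n.+2 q2 (fun z => b < `|ev n.+2 z G|).
  apply: nearW (cont_ev (F := id) G (fun i ik => cont_proj q2 ik) b0) _ => z h.
  rewrite -(ltrD2r b) -splitr; have := lerB_dist (ev n.+2 q2 G) (ev n.+2 z G).
  by rewrite lerBlDr => /le_lt_trans; apply; rewrite addrC ltrD2l distrC.
have [e1 [e10 e1e e1r]] := pos_min e0 rho0.
have [d1 d10 d1P] := zeros_lift pP aF e10 Pq lq.
have [e2 [e20 e2e1 e2d]] := pos_min e10 d10.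
have [r [phi [r0 phiP]]] := cP q (zeros_contract Pq) cq' e2 e20.
have /choice[chi chiP] s : exists t, `|s - q 0%N| < r ->
    zeros P (upd (phi s) n t) /\ `|t - q n| < e1.
  have [sr|] := boolP (`|s - q 0%N| < r); last by exists 0.
  have [_ Pphi phiq _] := phiP s sr.
  have [|t Pt te] := d1P (phi s) _ Pphi; last by exists t.
  by move=> i /phiq/lt_le_trans; apply.
exists r, (fun s => upd (phi s) n (chi s)); split=> // s sr.
have [phis Pphi phiq phid] := phiP s sr; have [Pchi chiq] := chiP s sr.
split=> //; first by rewrite upd_lt.
  move=> i; rewrite ltnS leq_eqVlt => /orP[/eqP ->|lin].
    by rewrite updE (lt_le_trans chiq).
  by rewrite upd_lt // (lt_le_trans (phiq i lin)) // (le_trans e2e1).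
have /choice[d dP] i : exists d, (i < n)%N -> hasder (fun s => phi s i) s d.
  by case: (boolP (i < n)%N) => [/phid[d]|_]; [exists d|exists 0].
move=> i; rewrite ltnS leq_eqVlt => /orP[/eqP ->|lin]; last first.
  exists (d i); have := dP i lin; congr hasder.
  by apply: funext => s'; rewrite upd_lt.
suff [d' hd] : exists d', hasder chi s d'.
  by exists d'; move: hd; congr hasder; apply: funext => s'; rewrite updE.
have [dE [h hE [ch _]]] : exists d', hasder (fun s' => ev n.+1 (upd (phi s') n (chi s)) F) s d'.
  apply: (@hasder_ev _ n.+1 (fun s' => upd (phi s') n (chi s)) s (upd d n 0)) => j.
  rewrite ltnS leq_eqVlt => /orP[/eqP ->|ljn].
    have := hasder_cst (chi s) s; rewrite updE; congr hasder.
    by apply: funext => s'; rewrite updE.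
  have := dP j ljn; rewrite upd_lt //; congr hasder.
  by apply: funext => s'; rewrite upd_lt.
pose r1 := r - `|s - q 0%N|.
have r10 : 0 < r1 by rewrite subr_gt0.
have disc s' : `|s' - s| < r1 -> `|s' - q 0%N| < r.
  rewrite /r1 ltrBrDr => /(le_lt_trans _); apply.
  have -> : s' - q 0%N = (s' - s) + (s - q 0%N) by rewrite addrA subrK.
  exact: ler_normD.
pose Gf s' := ev n.+2 (upd (upd (phi s') n (chi s)) n.+1 (chi s')) G.
have Gfb s' : `|s' - s| < r1 -> b < `|Gf s'|.
  move=> /disc s'r; apply: Gb => j; have [_ Pphi' phiq' _] := phiP s' s'r.
  have [_ chiq'] := chiP s' s'r; rewrite /q2.
  rewrite ltnS leq_eqVlt => /orP[/eqP ->|ljn].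
    by rewrite !updE (lt_le_trans chiq').
  rewrite !(upd_lt _ _ ljn); move: ljn.
  rewrite ltnS leq_eqVlt => /orP[/eqP ->|ljn].
    by rewrite !updE (lt_le_trans chiq).
  rewrite !(upd_lt _ _ ljn) (lt_le_trans (phiq' j ljn)) //.
  by rewrite (le_trans e2e1).
(* F vanishes at (phi s', chi s') and at (phi s, chi s), so its increment in the last variable
   cancels its increment along phi with the last variable frozen at [chi s]. *)
have key s' : `|s' - s| < r1 -> (chi s' - chi s) * Gf s' = - ((s' - s) * h s').
  move=> s'r; rewrite -hE -GE.
  have [Pchi' _] := chiP s' (disc _ s'r).
  by rewrite (Pchi' _ PF) (Pchi _ PF) subr0 sub0r.
have s_near (Q : C -> Prop) : (forall s', `|s' - s| < r1 -> Q s') ->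
    nearby 1 (fun=> s) (fun z => Q (z 0%N)).
  by move=> rQ; exists r1 => // z /(_ 0%N isT); apply: rQ.
have cchi : cont1 chi s.
  have cf : cont1 (fun s' => (s' - s) * h s') s.
    apply: contM => //; apply: contD; [exact: cont1_id|exact: cont_cst].
  move=> e' e'0; have be0 : 0 < e' * b by rewrite mulr_gt0.
  apply: nearW (nearI (cf _ be0) (s_near _ (fun s' => id))) _ => z [].
  rewrite subrr mul0r subr0 => hs' s'r; have Gs' := Gfb _ s'r.
  rewrite -(ltr_pM2r b0); apply: le_lt_trans hs'.
  by rewrite -[X in _ <= X]normrN -key // normrM ler_wpM2l // ltW.
have cG : cont1 Gf s.
  rewrite /cont1 /Gf.
  apply: (@cont_ev _ 1 n.+2 (fun z => upd (upd (phi (z 0%N)) n (chi s)) n.+1 (chi (z 0%N)))).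
  apply: (@cont_upd 1 n.+1 (fun z => chi (z 0%N)) (fun z => upd (phi (z 0%N)) n (chi s))) => //.
  apply: (@cont_upd 1 n (fun=> chi s) (fun z => phi (z 0%N))); last exact: cont_cst.
  by move=> j /dP/hasder_cont.
have Gs0 : Gf s != 0.
  by rewrite -normr_gt0 (lt_trans b0) // Gfb // subrr normr0.
(* Outside the disc the quotient only makes the Caratheodory identity global; continuity at s
   concerns the first branch. *)
eexists; exists (fun s' => if `|s' - s| < r1 then - h s' / Gf s' else (chi s' - chi s) / (s' - s)).
  move=> s'; case: ifP => [s'r|/negbT s'r].
    have Gn0 : Gf s' != 0 by rewrite -normr_gt0 (lt_trans b0) // Gfb.
    by apply: (mulIf Gn0); rewrite key // -mulrA divfK // mulrN.
  have s's : s' - s != 0.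
    by apply: contraNneq s'r => ->; rewrite normr0.
  by rewrite mulrC divfK.
split; last by [].
have := contM (contN ch) (contV Gs0 cG).
move=> cq2 e' e'0; apply: nearW (nearI (cq2 e' e'0) (s_near _ (fun s' => id))) _ => z [].
by rewrite subrr normr0 r10 => + ->.
Qed.

End Step.

(** Induction on the number of variables. A free variable other than z_0 stays free through all
    later levels; otherwise every level after z_0 is algebraic, and rigidity is passed on together
    with either a point or a curve. *)
Theorem local_structure n (P : PolT C n.+1 -> Prop) : prime_ideal P ->
  exists2 c, ~ P c & (exists2 k, (0 < k <= n)%N & lifts_at k P c) \/
    tangent_rigid P c /\ (point_ideal P \/ curve_through P c).
Proof.
elim: n P => [|n IH] P pP.
  have pP' := contract_prime pP.
  have [fP|[F aF]] := @one_level (PolT C 0) P pP.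
    exists 1; first by case: pP.
    right; split; first by move=> phi d s _ _ _ d0 [].
    right=> q Pq _ e e0; exists e, (fun s _ => s); split=> // s se; split=> //.
    - apply: zeros_free => //.
      by move=> r Pr; move: (zeros_contract Pq Pr).
    - by case.
    - by move=> i _; exists 1; apply: hasder_id.
  have [PF nl _] := aF; exists (1%:P * F^`()).
    rewrite mul1r; apply: (algebraic_level_deriv pP _ aF); exact: (PolT_char0 C 0).
  right; split.
    by apply: (@tangent_rigid_algebraic 0 P F aF (1 : PolT C 0)) => phi d s _ _ _ _ i.
  left; apply: (point_ideal_algebraic pP aF); exists (fun=> 0) => r /= r0.
  have {r0}-> : r = 0 by [].
  exact: ideal0 (contract_ideal pP).
have pP' := contract_prime pP; have [c Pc cP] := IH _ pP'.
have [fP|[F aF]] := @one_level (PolT C n.+1) P pP.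
  case: cP => [[k /andP[k0 kn] lP]|_].
    exists (c%:P : {poly PolT C n.+1}) => //; left; exists k.
      by rewrite k0 leqW.
    exact: lifts_at_free.
  exists 1; first by case: pP.
  left; exists n.+1; first by rewrite ltnS leqnn.
  exact: lifts_at_new.
have [PF nl _] := aF.
have PF' : ~ P F^`() by apply: (algebraic_level_deriv pP _ aF); apply: (PolT_char0 C n.+1).
have Pcl : ~ P ((c * lead_coef F)%:P) by apply: (primeM pP').
case: cP => [[k /andP[k0 kn] lP]|[tP cP]].
  exists ((c * lead_coef F)%:P : {poly PolT C n.+1}) => //.
  left; exists k; first by rewrite k0 leqW.
  exact: lifts_at_algebraic.
(* A single c serves both conclusions: the curve needs the leading coefficient nonzero to lift
   roots, and both use that F' is nonzero. *)
exists ((c * lead_coef F)%:P * F^`() : {poly PolT C n.+1}).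
  exact: primeM.
right; split.
  have := tangent_rigid_algebraic aF tP.
  move=> tP' phi d s hz; rewrite polyCM rmorphM mulf_eq0 negb_or => /andP[].
  rewrite rmorphM mulf_eq0 negb_or => /andP[h1 _] h2; apply: tP' => //.
  by rewrite rmorphM mulf_eq0 negb_or h1.
case: cP => cP; [left; exact: (point_ideal_algebraic pP aF)|right].
exact: curve_through_algebraic.
Qed.

End LocalStructure.

(** * Compact pieces of algebraic sets *)

Section Vanishing.
Variable C : numClosedFieldType.
Implicit Types (S : (nat -> C) -> Prop).

Definition vanish n S (p : PolT C n) := forall z, S z -> ev n z p = 0.

Lemma vanish_ideal n S : ideal (vanish (n := n) S).
Proof.
split=> [z _|x y Vx Vy z Sz|a x Vx z Sz]; first by rewrite rmorph0.
  by rewrite rmorphD Vx ?Vy ?addr0.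
by rewrite rmorphM Vx ?mulr0.
Qed.

Lemma zeros_vanish n S z : S z -> zeros (vanish (n := n) S) z.
Proof. by move=> Sz p; apply. Qed.

(** S is chosen in F with maximal vanishing ideal. If f g vanishes on S, the member S' on which f or
    g vanishes has an ideal containing that of S, hence the same one. *)
Lemma prime_vanish n (F : ((nat -> C) -> Prop) -> Prop) :
  (exists S, F S) -> (forall S, F S -> exists z, S z) ->
  (forall S f g, F S -> vanish S (f * g) -> exists S',
     [/\ F S', forall z, S' z -> S z & vanish (n := n) S' f \/ vanish S' g]) ->
  exists S, [/\ F S, prime_ideal (vanish (n := n) S) &
    forall S', F S' -> (forall p : PolT C n, vanish S p -> vanish S' p) ->
      forall p : PolT C n, vanish S' p -> vanish S p].
Proof.
move=> [S0 FS0] Fn Fsplit.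
have [||P [[S [FS PE]] Pmax]] := @noetherian_max _
  (fun I : PolT C n -> Prop => exists S, F S /\ I = vanish S) (@noetherian_PolT C n).
- by move=> _ [S [_ ->]]; apply: vanish_ideal.
- by exists (vanish S0), S0.
have Smax S' : F S' -> (forall p : PolT C n, vanish S p -> vanish S' p) ->
    forall p : PolT C n, vanish S' p -> vanish S p.
  by move=> FS'; rewrite -PE; apply: Pmax; exists S'.
exists S; split=> //; split; first exact: vanish_ideal.
  have [z Sz] := Fn S FS; move=> /(_ z Sz)/eqP.
  by rewrite rmorph1 oner_eq0.
move=> f g /(Fsplit _ _ _ FS)[S' [FS' S'S fg]].
have sub (p : PolT C n) : vanish S' p -> vanish S p.
  by apply: Smax => // r Vr z /S'S/Vr.
by case: fg => /sub; [left|right].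
Qed.

(** Points matter only through their first n coordinates, so finiteness is expressed by one finite
    list containing all of these. *)
Definition fin_pts n S := exists s : seq C, forall z, S z -> forall i, (i < n)%N -> z i \in s.

Lemma fin_ptsU n S1 S2 : fin_pts n S1 -> fin_pts n S2 ->
  fin_pts n (fun z => S1 z \/ S2 z).
Proof.
move=> [s1 h1] [s2 h2]; exists (s1 ++ s2) => z [Sz|Sz] i lin; rewrite mem_cat.
  by rewrite h1.
by rewrite h2 ?orbT.
Qed.

Lemma fin_ptsS n S1 S2 : (forall z, S1 z -> S2 z) -> fin_pts n S2 -> fin_pts n S1.
Proof. by move=> S12 [s h]; exists s => z /S12; apply: h. Qed.

(** The family is that of the infinite subsets of S: if f g vanishes on an infinite set, f or g
    vanishes on an infinite part of it. Maximality survives as the last clause: an infinite subset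
    of S lying in the zeros of the ideal satisfies no further equation. *)
Lemma infinite_prime n S : ~ fin_pts n S -> exists S0,
  [/\ ~ fin_pts n S0, forall z, S0 z -> S z, prime_ideal (vanish (n := n) S0) &
      forall S', (forall z, S' z -> S z) -> 
        (forall z, S' z -> zeros (vanish (n := n) S0) z) ->
        ~ fin_pts n S' -> forall p : PolT C n, vanish S' p -> vanish S0 p].
Proof.
move=> nS; pose F T := ~ fin_pts n T /\ forall z, T z -> S z.
have [|T [nT _]|T f g [nT TS] Tfg|S0 [[nS0 S0S] pS0 S0max]] := @prime_vanish n F.
- by exists S.
- apply: contrapT => nz; apply: nT; exists [::] => z Tz.
  by case: nz; exists z.
- have fin2 : ~ (fin_pts n (fun z => T z /\ ev n z f = 0) /\
                 fin_pts n (fun z => T z /\ ev n z g = 0)).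
    move=> [h1 h2]; apply: nT; apply: fin_ptsS (fin_ptsU h1 h2) => z Tz.
    have /eqP := Tfg z Tz; rewrite rmorphM mulf_eq0.
    by case/orP => /eqP; [left|right].
  have [h1|h1] := EM (fin_pts n (fun z => T z /\ ev n z f = 0)).
    exists (fun z => T z /\ ev n z g = 0); split; [|by move=> z []|by right=> z []].
    split; first by move=> h2; apply: fin2.
    by move=> z [/TS].
  exists (fun z => T z /\ ev n z f = 0); split; [|by move=> z []|by left=> z []].
  by split=> // z [/TS].
exists S0; split=> // S' S'S S'Z nS'; apply: S0max => // p Vp z /S'Z; exact.
Qed.

Lemma zeros_point n (P : PolT C n -> Prop) : point_ideal P ->
  exists a, forall z, zeros P z -> forall i, (i < n)%N -> z i = a i.
Proof.
move=> [a aP]; exists a => z Pz i lin; apply/eqP; rewrite -subr_eq0; apply/eqP.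
have := Pz (var C n i - cst C n (a i)); rewrite rmorphB ev_var // ev_cst; apply.
by apply: aP; rewrite rmorphB ev_var // ev_cst subrr.
Qed.

Lemma exists_avoiding (s : seq C) a d : 0 < d -> exists2 t, t \notin s & `|t - a| < d.
Proof.
move=> d0; apply: contrapT => nt.
(* One point more than s has entries, all distinct; the denominators start at 2 to stay strictly
   inside the disc. *)
pose u := [seq a + d / (i + 2)%:R | i <- iota 0 (size s).+1].
have uu : uniq u.
  rewrite map_inj_in_uniq ?iota_uniq // => i j _ _ /addrI/(mulfI (lt0r_neq0 d0)).
  by move/invr_inj/eqP; rewrite eqr_nat eqn_add2r => /eqP.
have us : {subset u <= s}.
  move=> _ /mapP[i _ ->]; apply: contrapT => /negP ns; apply: nt; eexists; first exact: ns.
  rewrite addrC addKr gtr0_norm ?divr_gt0 // ?ltr0n ?addn2 //.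
  by rewrite ltr_pdivrMr ?ltr0n // ltr_pMr // ltr1n.
by have := uniq_leq_size uu us; rewrite size_map size_iota ltnn.
Qed.

End Vanishing.

Section CompactFinite.
Variables (C : numClosedFieldType) (n : nat).
Variables (D : (nat -> C) -> Prop).
Hypothesis D_open : forall z, D z -> nearby n.+1 z D.

Lemma local_structure_weak (P : PolT C n.+1 -> Prop) : prime_ideal P ->
  point_ideal P \/ exists2 c, ~ P c & exists2 k, (k <= n)%N &
    forall q, zeros P q -> ev n.+1 q c != 0 -> forall e : C, 0 < e ->
    exists2 d : C, 0 < d & forall t, `|t - q k| < d -> exists z,
      [/\ zeros P z, forall i, (i < n.+1)%N -> `|z i - q i| < e & z k = t].
Proof.
move=> pP; have [c Pc [[k /andP[_ kn] lP]|[_ [|cP]]]] := local_structure pP.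
- right; exists c => //; exists k => // q Pq cq e e0.
  have [d d0 dP] := lP q Pq cq e e0; exists d => // t /dP[z [Pz zq zk _]].
  by exists z.
- by left.
- right; exists c => //; exists 0%N => // q Pq cq e e0.
  have [r [phi [r0 rP]]] := cP q Pq cq e e0; exists r => // t /rP[h1 h2 h3 _].
  by exists (phi t).
Qed.

(** The hypothesis is compactness in the form needed: the modulus of a polynomial attains its
    maximum on every nonempty part in D of a zero set cut out by further equations. *)
Theorem compact_zeros_finite (I0 : PolT C n.+1 -> Prop) :
  (forall (I : PolT C n.+1 -> Prop) (p : PolT C n.+1), (forall x, I0 x -> I x) ->
     (exists z, zeros I z /\ D z) -> exists z, [/\ zeros I z, D z &
       forall z', zeros I z' -> D z' -> `|ev n.+1 z' p| <= `|ev n.+1 z p|]) ->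
  fin_pts n.+1 (fun z => zeros I0 z /\ D z).
Proof.
move=> attain; apply: contrapT => /infinite_prime[S0 [nS0 S0S pS0 S0max]].
set P := vanish S0 in pS0 S0max.
have I0P x : I0 x -> P x by move=> I0x z /S0S[/(_ x I0x)].
have [/zeros_point[a aP]|[c Pc [k kn lP]]] := local_structure_weak pS0.
  apply: nS0; exists [seq a i | i <- iota 0 n.+1] => z /zeros_vanish/aP zi i lin.
  by rewrite zi //; apply/mapP; exists i => //; rewrite mem_iota.
(* An infinite exceptional locus would put c in P by the maximality of P. *)
have [s sP] : fin_pts n.+1 (fun z => [/\ zeros P z, D z & ev n.+1 z c = 0]).
  apply: contrapT => nfin; apply: Pc; apply: (S0max (fun z => [/\ zeros P z, D z & ev n.+1 z c = 0])) => //.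
  - by move=> z [Pz Dz _]; split=> // p /I0P/Pz.
  - by move=> z [].
  - by move=> z [].
(* The factors over s push the maximum off the exceptional points; the factor ['X] keeps Q
   nonconstant when s is empty. *)
pose Q : {poly C} := 'X * \prod_(a <- s) ('X - a%:P).
have Qm : Q \is monic by rewrite monicMl ?monicX // monic_prod_XsubC.
have sQ : (1 < size Q)%N.
  by rewrite size_monicM ?monicX ?monic_neq0 ?monic_prod_XsubC // size_polyX size_prod_XsubC.
pose p : PolT C n.+1 := hom (cst C n.+1) (fun=> var C n.+1 k) 1 Q.
have pE z : ev n.+1 z p = Q.[z k].
  rewrite ev_hom (ev_ext (z' := fun=> z k)); last by move=> i _; rewrite ev_var.
  by rewrite evS (_ : map_poly _ Q = Q) //; apply: map_poly_id.
have step z : zeros P z -> D z -> ev n.+1 z c != 0 ->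
   exists2 d : C, 0 < d & forall t, `|t - z k| < d ->
     exists z', [/\ zeros P z', D z' & z' k = t].
  move=> Pz Dz cz; have [e e0 eD] := D_open Dz.
  have [d d0 dP] := lP z Pz cz e e0; exists d => // t /dP[z' [Pz' zz' z'k]].
  by exists z'; split=> //; apply: eD.
have [q [Sq cq]] : exists q, S0 q /\ ev n.+1 q c != 0.
  apply: contrapT => nq; apply: Pc => z Sz; apply/eqP; apply: contrapT => /negP h.
  by apply: nq; exists z.
have [_ Dq] := S0S q Sq.
have [d d0 dP] := step q (zeros_vanish Sq) Dq cq.
have [t ts /dP[z0 [Pz0 Dz0 z0k]]] := exists_avoiding (0 :: s) (q k) d0.
have Qt : Q.[t] != 0.
  move: ts; rewrite in_cons negb_or => /andP[t0 ts].
  rewrite hornerM hornerX mulf_neq0 //.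
  by move: ts; rewrite -root_prod_XsubC.
have [z [Pz Dz zmax]] : exists z, [/\ zeros P z, D z &
    forall z', zeros P z' -> D z' -> `|ev n.+1 z' p| <= `|ev n.+1 z p|].
  by apply: attain => //; exists z0.
have Qz : Q.[z k] != 0.
  have := zmax z0 Pz0 Dz0; rewrite !pE z0k; apply: contraTneq => ->.
  by rewrite normr0 normr_le0.
have cz : ev n.+1 z c != 0.
  apply: contraNneq Qz => cz; rewrite hornerM mulf_eq0; apply/orP; right.
  by rewrite -/(root _ _) root_prod_XsubC; apply: sP.
have [d' d'0 d'P] := step z Pz Dz cz.
(* The modulus of eta Q(z_k) is half of d' to the power deg Q, so [root_near] finds w within d' of
   z_k with Q(w) = (1 + eta) Q(z_k), which exceeds the maximum. *)
pose eta := d' ^+ (size Q).-1 / `|Q.[z k]| / 2%:R.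
have eta0 : 0 < eta by rewrite !divr_gt0 ?exprn_gt0 ?normr_gt0.
pose Q' := Q - ((1 + eta) * Q.[z k])%:P.
have sC : (size (- ((1 + eta) * Q.[z k])%:P) < size Q)%N.
  by rewrite size_polyN (leq_ltn_trans (size_polyC_leq1 _)).
have [||w /rootP Q'w wz] := @root_near _ Q' (z k) d' => //.
  rewrite /Q' lead_coefDl // (monicP Qm) normr1 mul1r size_polyDl //.
  rewrite hornerD hornerN hornerC mulrDl mul1r opprD addrA subrr sub0r normrN normrM.
  rewrite gtr0_norm // /eta -!mulrA [_^-1 * (_ * _)]mulrCA mulVf ?normr_eq0 // mulr1.
  by rewrite ltr_pdivrMr // ltr_pMr ?ltr1n // exprn_gt0.
have [z' [Pz' Dz' z'k]] := d'P w wz.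
have := zmax z' Pz' Dz'; rewrite !pE z'k.
have -> : Q.[w] = (1 + eta) * Q.[z k].
  by apply/eqP; rewrite -subr_eq0 -Q'w /Q' hornerD hornerN hornerC.
rewrite normrM (gtr0_norm (_ : 0 < 1 + eta)) ?addr_gt0 // mulrDl mul1r.
by rewrite gerDl lt_geF // mulr_gt0 // normr_gt0.
Qed.

End CompactFinite.

(** * Shears and Gauss' lemma *)

Section Weights.
Variables (C : fieldType) (B : idomainType) (b : {rmorphism C -> B}) (y : nat -> B).

(** A Nagata substitution. The last variable has weight w and each earlier one K times the weight of
    its successor, so peeling off the last variable replaces w by w K. *)
Definition weighted_shift n w K : {rmorphism PolT C n -> {poly B}} :=
  hom ((polyC : {rmorphism B -> {poly B}}) \o b)
    (fun i => 'X^(w * K ^ (n.-1 - i)) + (y i)%:P) n.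

Lemma weighted_shiftMXaddC n w K (p : {poly PolT C n}) (c : PolT C n) :
  weighted_shift n.+1 w K (p * 'X + c%:P) =
    weighted_shift n.+1 w K p * ('X^w + (y n)%:P) + weighted_shift n (w * K) K c.
Proof.
rewrite [LHS]homMXaddC subnn muln1; congr (_ + _).
apply: (hom_comp (g := idfun)) => // i lin; rewrite -mulnA -expnS.
by rewrite /= -subn1 subnAC subn1 prednK // subn_gt0.
Qed.

(* The weights w K^(n-1-i) separate the monomials of p once K is large, so a
   single monomial contributes the top power of the new variable. *)
Lemma weighted_shift_lead n (p : PolT C n) : p != 0 ->
  exists K0, forall K w, (K0 <= K)%N -> (0 < w)%N -> exists e (c : C),
    [/\ c != 0, lead_coef (weighted_shift n w K p) = b c &
        size (weighted_shift n w K p) = (w * e).+1].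
Proof.
elim: n p => [|n IH] p pn0.
  exists 0%N => K w _ _; exists 0%N, p; rewrite /weighted_shift /= lead_coefC muln0.
  by split=> //; rewrite size_polyC fmorph_eq0 pn0.
(* The degree is refined to w (K e + i) with i less than the size in the last variable: residues
   modulo K then separate the two summands of the recursion. *)
suff [K0 K0P] : exists K0, forall K w, (K0 <= K)%N -> (0 < w)%N -> exists e i (c : C),
    [/\ c != 0, (i < size (p : {poly PolT C n}))%N,
        lead_coef (weighted_shift n.+1 w K p) = b c &
        size (weighted_shift n.+1 w K p) = (w * (K * e + i)).+1].
  exists K0 => K w /K0P /[apply] -[e [i [c [c0 _ lc sc]]]].
  by exists (K * e + i)%N, c.
elim/poly_ind: p pn0 => [|q a IHq] pn0; first by rewrite eqxx in pn0.
have sz := size_MXaddC q a.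
have [q0|qn0] := eqVneq q 0.
  have an0 : a != 0 by apply: contraNneq pn0 => ->; rewrite q0 mul0r addr0.
  have [K0 K0P] := IH a an0; exists (maxn 1 K0) => K w; rewrite geq_max => /andP[Kp KK] w0.
  have wK0 : (0 < w * K)%N by rewrite muln_gt0 w0.
  have [e [c [c0 lc sc]]] := K0P K (w * K)%N KK wK0.
  exists e, 0%N, c; rewrite sz weighted_shiftMXaddC q0 eqxx (negPf an0).
  by rewrite rmorph0 mul0r add0r addn0 mulnA.
have [K1 K1P] := IHq qn0.
have sq : size (q * 'X + a%:P) = (size q).+1 by rewrite sz (negPf qn0).
have lin w : (0 < w)%N -> lead_coef ('X^w + (y n)%:P) = 1 /\ size ('X^w + (y n)%:P) = w.+1.
  by move=> w0; rewrite lead_coefXnaddC // size_XnaddC.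
have mulS w K e i c : (0 < w)%N -> c != 0 ->
    lead_coef (weighted_shift n.+1 w K q) = b c ->
    size (weighted_shift n.+1 w K q) = (w * (K * e + i)).+1 ->
    lead_coef (weighted_shift n.+1 w K q * ('X^w + (y n)%:P)) = b c /\
    size (weighted_shift n.+1 w K q * ('X^w + (y n)%:P)) = (w * (K * e + i.+1)).+1.
  move=> w0 c0 lc sc; have [l1 s1] := lin w w0.
  rewrite lead_coefM lc l1 mulr1 size_mul ?sc ?s1.
  - by rewrite !addnS addSn mulnS [(w + _)%N]addnC.
  - by rewrite -size_poly_eq0 sc.
  - by rewrite -size_poly_eq0 s1.
have [a0|an0] := eqVneq a 0.
  exists K1 => K w KK w0; have [e [i [c [c0 iq lc sc]]]] := K1P K w KK w0.
  have [l2 s2] := mulS w K e i c w0 c0 lc sc.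
  exists e, i.+1, c; rewrite sq weighted_shiftMXaddC a0 rmorph0 addr0.
  by split.
have [K2 K2P] := IH a an0.
exists (maxn (size q).+1 (maxn K1 K2)) => K w; rewrite !geq_max => /and3P[Kq KK1 KK2] w0.
have [e [i [c [c0 iq lc sc]]]] := K1P K w KK1 w0.
have [l2 s2] := mulS w K e i c w0 c0 lc sc.
have K0 : (0 < K)%N by apply: leq_trans Kq.
have wK0 : (0 < w * K)%N by rewrite muln_gt0 w0.
have [e' [c' [c'0 lc' sc']]] := K2P K (w * K)%N KK2 wK0.
rewrite sq weighted_shiftMXaddC; set u := _ * _ in l2 s2 *; set v := weighted_shift _ _ _ _ in lc' sc' *.
have [h|h|h] := ltngtP (size u) (size v).
- by exists e', 0%N, c'; rewrite lead_coefDr // addrC size_polyDl // addn0 mulnA.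
- by exists e, i.+1, c; rewrite lead_coefDl // size_polyDl.
(* Equal sizes would make i + 1 congruent to 0 modulo K, although 0 < i + 1 < K. *)
have : ((K * e + i.+1) %% K = (K * e') %% K)%N.
  congr (_ %% _)%N; apply/eqP; rewrite -(eqn_pmul2l w0) mulnA -eqSS -s2 -sc' h //.
rewrite modnMr mulnC modnMDl modn_small //.
by apply: leq_trans Kq; rewrite ltnS.
Qed.

End Weights.

Section Shears.
Variables (C : numFieldType) (n : nat).
Implicit Types (phi : nat -> {poly C}) (z : nat -> C).

Definition shear_var phi i : PolT C n.+1 :=
  (if (i < n)%N then (var C n i)%:P + map_poly (cst C n) (phi i)
   else 'X : {poly PolT C n}).

Definition shear phi : {rmorphism PolT C n.+1 -> PolT C n.+1} :=
  hom (cst C n.+1) (shear_var phi) n.+1.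

Definition shear_pt phi z i := ev n.+1 z (shear_var phi i).

Lemma ev_shear phi z h : ev n.+1 z (shear phi h) = ev n.+1 (shear_pt phi z) h.
Proof. exact: ev_hom. Qed.

Lemma shear_pt_lt phi z i : (i < n)%N -> shear_pt phi z i = z i + (phi i).[z n].
Proof.
move=> lin; rewrite /shear_pt /shear_var lin rmorphD evC ev_var //; congr (_ + _).
by rewrite evS -map_poly_comp map_poly_id // => c _ /=; rewrite ev_cst.
Qed.

Lemma shear_ptn phi z : shear_pt phi z n = z n.
Proof. by rewrite /shear_pt /shear_var ltnn evX. Qed.

Lemma shear_ptK phi z i : (i < n.+1)%N ->
  shear_pt (fun i => - phi i) (shear_pt phi z) i = z i.
Proof.
rewrite ltnS leq_eqVlt => /orP[/eqP ->|lin]; first by rewrite !shear_ptn.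
by rewrite shear_pt_lt // shear_ptn shear_pt_lt // hornerN addrK.
Qed.

Lemma shear_ptNK phi z i : (i < n.+1)%N ->
  shear_pt phi (shear_pt (fun i => - phi i) z) i = z i.
Proof.
rewrite ltnS leq_eqVlt => /orP[/eqP ->|lin]; first by rewrite !shear_ptn.
by rewrite shear_pt_lt // shear_ptn shear_pt_lt // hornerN subrK.
Qed.

Lemma ev_inj m (p q : PolT C m) : (forall z, ev m z p = ev m z q) -> p = q.
Proof.
move=> pq; apply/eqP; rewrite -subr_eq0; apply/eqP/ev_inj0 => z.
by rewrite rmorphB pq subrr.
Qed.

Lemma shearK phi : cancel (shear phi) (shear (fun i => - phi i)).
Proof.
move=> h; apply: ev_inj => z; rewrite !ev_shear; apply: ev_ext => i.
exact: shear_ptNK.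
Qed.

Lemma shear_monic (f : PolT C n.+1) : f != 0 -> exists phi (c : C),
  c != 0 /\ lead_coef (shear phi f : {poly PolT C n}) = cst C n c.
Proof.
(* With y_n = 0 and w = 1 the weighted substitution fixes z_n, so it is a shear. *)
move=> fn0; pose y i := if (i < n)%N then var C n i else 0.
have [K0 K0P] := weighted_shift_lead (cst C n) y fn0.
have [e [c [c0 lc _]]] := K0P K0 1%N (leqnn _) isT.
exists (fun i => 'X^(1 * K0 ^ (n - i))), c; split=> //.
rewrite -lc; congr (lead_coef _); apply: esym.
rewrite /weighted_shift; apply: (hom_comp (g := idfun)) => // i.
rewrite ltnS leq_eqVlt /shear_var /y /= => /orP[/eqP ->|lin].
  by rewrite ltnn subnn muln1 expr1 addr0.
by rewrite lin map_polyXn addrC.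
Qed.

End Shears.

Section Gauss.
Variable C : numClosedFieldType.

(** Induction on the degree of e. At a root a of e, one of A and F is divisible by X - a, which is
    cancelled; when it is F, the factor leaves its leading coefficient and all its coefficients
    alike. Once e is constant, the leading coefficient of F is a unit. *)
Lemma gauss_univariate (A F f : {poly {poly C}}) (e : {poly C}) (k : C) :
  e != 0 -> k != 0 -> lead_coef f = k%:P -> e *: f = A * F ->
  forall i, lead_coef F %| F`_i.
Proof.
move=> + k0 fk; have [m] := ubnP (size e).
elim: m e A F => // m IH e A F; rewrite ltnS => sem en0 E.
have [/eqP/size_poly1P[c c0 ec] i|se] := eqVneq (size e) 1%N.
  have lF : lead_coef F %| (c * k)%:P.
    by rewrite polyCM -ec -fk -lead_coefZ E lead_coefM dvdp_mull.
  apply: (dvdp_trans lF); rewrite (eqp_dvdl _ (_ : _ %= 1)) ?dvd1p //.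
  by rewrite -size_poly_eq1 size_polyC mulf_neq0.
have [a /factor_theorem[e1 eE]] : exists a, root e a by apply/closed_rootP.
have e1n0 : e1 != 0 by apply: contraNneq en0 => e10; rewrite eE e10 mul0r.
have Xa : 'X - a%:P != 0 :> {poly C} by rewrite polyXsubC_eq0.
have s1 : (size e1 < m)%N.
  by apply: leq_trans sem; rewrite eE size_Mmonic ?monicXsubC // size_XsubC addn2.
pose ea := map_poly (horner_eval a).
have split_a (G : {poly {poly C}}) : ea G = 0 ->
    exists G1, G = ('X - a%:P) *: G1.
  move=> G0; have cG i : exists q, G`_i = q * ('X - a%:P).
    apply/factor_theorem/rootP.
    by have /polyP/(_ i) := G0; rewrite coef_map coef0.
  have [q qP] := choice cG; exists (\poly_(i < size G) q i).
  apply/polyP => i; rewrite coefZ coef_poly; case: ltnP => [_|h].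
    by rewrite qP mulrC.
  by rewrite nth_default // mulr0.
have : ea A * ea F = 0.
  rewrite -rmorphM -E -mul_polyC rmorphM /= map_polyC /= /horner_eval eE hornerM.
  by rewrite !hornerE subrr mulr0 mul0r.
move/eqP; rewrite mulf_eq0 => /orP[] /eqP/split_a[G1 GE].
  apply: (IH e1 G1) => //.
  apply: (@mulfI _ (('X - a%:P)%:P : {poly {poly C}})); first by rewrite polyC_eq0.
  by rewrite !mul_polyC scalerA mulrC -eE E GE -!mul_polyC mulrA.
have E1 : e1 *: f = A * G1.
  apply: (@mulfI _ (('X - a%:P)%:P : {poly {poly C}})); first by rewrite polyC_eq0.
  by rewrite !mul_polyC scalerA mulrC -eE E GE -!mul_polyC mulrCA.
move=> i; rewrite GE lead_coefZ coefZ dvdp_mul2l //.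
exact: (IH e1 A G1).
Qed.

(* Divide the coefficients of F by c = lead_coef F.  After specializing all but
   one of the variables of c the univariate case applies, so the remainders
   vanish at every point. *)
Lemma gauss_monic n (A F f : {poly {poly PolT C n}}) N (k k' : C) :
  k != 0 -> lead_coef f = (cst C n k)%:P ->
  k' != 0 -> lead_coef (lead_coef F) = cst C n k' ->
  lead_coef F ^+ N *: f = A * F -> exists F', F = lead_coef F *: F'.
Proof.
move=> k0 fk k'0 lk' E; set c := lead_coef F in lk' E *.
pose c1 := (cst C n k'^-1)%:P * c.
have cE : c = (cst C n k')%:P * c1.
  by rewrite /c1 mulrA -polyCM -rmorphM mulfV // rmorph1 mul1r.
have c1m : c1 \is monic.
  by rewrite monicE lead_coefM lead_coefC lk' -rmorphM mulVf // rmorph1.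
have cz z : map_poly (ev n z) c != 0.
  have h : ev n z (lead_coef c) != 0 by rewrite lk' ev_cst.
  by rewrite map_poly_eq0_id0 // -lead_coef_eq0; apply: contraNneq h => ->; rewrite rmorph0.
have cF i : exists q, F`_i = c * q.
  have Fi := Pdiv.RingMonic.rdivp_eq c1m F`_i.
  set q := Pdiv.CommonRing.rdivp _ _ in Fi; set r := Pdiv.CommonRing.rmodp _ _ in Fi.
  suff r0 : r = 0.
    exists ((cst C n k'^-1)%:P * q).
    by rewrite Fi r0 addr0 mulrC /c1 -mulrA mulrCA.
  have sr : (size r < size c1)%N by rewrite Pdiv.CommonRing.ltn_rmodp monic_neq0.
  suff rz z : map_poly (ev n z) r = 0.
    apply/polyP => j; rewrite coef0; apply: ev_inj0 => z.
    by have /polyP/(_ j) := rz z; rewrite coef_map coef0.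
  pose mz : {rmorphism {poly PolT C n} -> {poly C}} := map_poly (ev n z).
  have div : mz c %| mz F`_i.
    have lF : lead_coef (map_poly mz F) = mz c.
      by rewrite lead_coef_map_id0 ?rmorph0 //; apply: cz. 
    have := @gauss_univariate (map_poly mz A) (map_poly mz F) (map_poly mz f) (mz c ^+ N) k.
    rewrite lF expf_neq0; last exact: cz.
    move=> /(_ isT k0) h.
    have := h _ _ i; rewrite coef_map; apply.
      rewrite lead_coef_map_id0 ?rmorph0 // fk /mz /= map_polyC /= ev_cst //.
      by rewrite polyC_eq0.
    by rewrite -rmorphXn -[RHS]rmorphM -E -!mul_polyC rmorphM /= map_polyC.
  have c1E : mz c = k' *: mz c1.
    by rewrite {1}cE rmorphM /= /mz map_polyC /= ev_cst mul_polyC.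
  have div1 : mz c1 %| mz r.
    have -> : mz r = mz F`_i - mz q * mz c1.
      by rewrite Fi rmorphD rmorphM /= addrC addKr.
    by rewrite dvdp_sub ?dvdp_mull // -(dvdpZl _ _ k'0) -c1E.
  apply/eqP; apply: contraT => rn0; have := dvdp_leq rn0 div1.
  have -> : size (mz c1) = size c1.
    by apply: size_map_poly_id0; rewrite (monicP c1m) rmorph1 oner_neq0.
  by move=> /leq_trans /(_ (size_poly _ _)); rewrite leqNgt sr.
have [q qP] := choice cF; exists (\poly_(i < size F) q i).
apply/polyP => i; rewrite coefZ coef_poly; case: ltnP => [_|h]; first exact: qP.
by rewrite nth_default // mulr0.
Qed.

(** A shear makes the leading coefficient of F monic, up to a constant, in its last variable, which
    is the case of [gauss_monic]; the inverse shear brings the conclusion back. *)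
Theorem gauss n (A F f : {poly PolT C n}) N (k : C) :
  k != 0 -> lead_coef f = cst C n k ->
  lead_coef F ^+ N *: f = A * F -> exists F', F = lead_coef F *: F'.
Proof.
move=> k0 fk E; have [->|Fn0] := eqVneq F 0; first by exists 0; rewrite scaler0.
case: n A F f k0 fk E Fn0 => [|n] A F f k0 fk E Fn0.
  exists ((lead_coef F : C)^-1 *: F); rewrite scalerA mulfV ?scale1r //.
  by rewrite lead_coef_eq0.
have cn0 : lead_coef F != 0 by rewrite lead_coef_eq0.
have [phi [k' [k'0 lk']]] := shear_monic cn0.
pose s : {rmorphism {poly PolT C n.+1} -> {poly PolT C n.+1}} := map_poly (shear n phi); pose t : {rmorphism {poly PolT C n.+1} -> {poly PolT C n.+1}} := map_poly (shear n (fun i => - phi i)).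
have st : cancel s t.
  move=> G; rewrite /s /t /= -map_poly_comp map_poly_id // => x _ /=.
  exact: shearK.
have slF : lead_coef (s F) = shear n phi (lead_coef F).
  apply: lead_coef_map_id0; first exact: rmorph0.
  by rewrite -lead_coef_eq0 lk' fmorph_eq0.
have [|||F' F'E] := @gauss_monic n (s A) (s F) (s f) N k k' k0 _ k'0.
- rewrite lead_coef_map_id0 ?rmorph0 // fk; last first.
    by rewrite hom_cst fmorph_eq0.
  by rewrite hom_cst.
- by rewrite slF.
- rewrite slF -[RHS]rmorphM -E -rmorphXn -!mul_polyC /s rmorphM /= map_polyC //.
exists (t F'); rewrite -[LHS]st F'E slF -!mul_polyC /t rmorphM /= map_polyC /=.
by rewrite [X in X%:P]shearK.
Qed.

End Gauss.

(** * Isolated points *)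

Section Elimination.
Variable C : numClosedFieldType.
Implicit Types (z p : nat -> C).
Local Notation ctr P := (contract (R := PolT C _) P).

Lemma map_evK n z (h : {poly C}) :
  map_poly (ev n z) (map_poly (cst C n) h) = h.
Proof. by rewrite -map_poly_comp map_poly_id // => c _ /=; rewrite ev_cst. Qed.

(* The resultant of g and of the monic polynomial g X^k + h belongs to P, hence
   vanishes at z, although g and g X^k + 1 are coprime. *)
Lemma eval_eq1_absurd n (P : PolT C n.+1 -> Prop) (g h : {poly PolT C n}) z :
  ideal P -> P g -> P h -> g \is monic -> zeros (ctr P) z ->
  map_poly (ev n z) h = 1 -> False.
Proof.
move=> iP Pg Ph gm Pz h1; pose q := g * 'X^(size h) + h.
have sgX : (size h < size (g * 'X^(size h))%R)%N.
  rewrite size_Mmonic ?monicXn ?monic_neq0 // size_polyXn addnS /=.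
  by rewrite -[X in (X < _)%N]add0n ltn_add2r lt0n size_poly_eq0 monic_neq0.
have qm : q \is monic.
  by rewrite monicE lead_coefDl // lead_coef_Mmonic ?monicXn // -monicE.
have Pq : P q by apply: idealD => //; apply: idealMr.
pose up : {rmorphism {poly PolT C n} -> {poly {poly PolT C n}}} := map_poly polyC.
pose at0 : {rmorphism {poly PolT C n} -> PolT C n} := horner_eval 0.
pose dn : {rmorphism {poly {poly PolT C n}} -> {poly PolT C n}} := map_poly at0.
have upK : cancel up dn.
  move=> r; rewrite /up /dn /= -map_poly_comp map_poly_id // => c _ /=.
  by rewrite /horner_eval hornerC.
pose f : {rmorphism {poly PolT C n} -> C} := ev n z \o at0.
have fup r : map_poly f (up r) = map_poly (ev n z) r.
  rewrite /up /= -map_poly_comp; apply: eq_map_poly => c.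
  by rewrite /f /= /horner_eval hornerC.
have lup r : r \is monic -> f (lead_coef (up r)) != 0.
  move=> rm; rewrite /up /= lead_coef_map_inj //; last exact: polyC_inj.
  by rewrite (monicP rm) !rmorph1 oner_neq0.
have sup r : size (up r) = size r by apply: size_map_inj_poly; [exact: polyC_inj|].
have [sg|sg] := leqP (size g) 1.
  have g1 : g = 1.
    by move: gm; rewrite (size1_polyC sg) monicE lead_coefC => /eqP ->.
  have P1 : P 1%:P by rewrite -[1%:P]/(1 : {poly PolT C n}) -g1.
  have /eqP := Pz 1 P1.
  by rewrite rmorph1 oner_eq0.
have sq : (1 < size q)%N.
  by rewrite size_polyDl // (leq_trans sg) // size_Mmonic ?monic_neq0 ?monicXn //
    size_polyXn addnS leq_addr.
have := @resultant_in_ideal {poly PolT C n} (up g) (up q).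
rewrite !sup => /(_ sg sq)[[u v] _ /= E].
have : P (at0 (resultant (up g) (up q)))%:P.
  have -> : (at0 (resultant (up g) (up q)))%:P = dn (resultant (up g) (up q))%:P.
    by rewrite /dn /= map_polyC.
  rewrite E rmorphD !rmorphM !upK; apply: idealD => //; exact: idealMl.
move/Pz; have -> : ev n z (at0 (resultant (up g) (up q))) = f (resultant (up g) (up q)) by [].
rewrite map_resultant ?lup // !fup => /eqP; rewrite resultant_eq0 => sgcd.
have [|t] := closed_rootP (gcdp (map_poly (ev n z) g) (map_poly (ev n z) q)) _.
  by rewrite neq_ltn sgcd orbT.
rewrite root_gcd => /andP[/rootP gt /rootP].
rewrite rmorphD rmorphM /= h1 hornerD hornerM gt mul0r add0r hornerC.
by move/eqP; rewrite oner_eq0.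
Qed.

(** The specialisations at z of the members of P form an ideal of C[X], generated by one of least
    degree. A root of it gives the point; if it were constant, some member of P would specialise to
    1, contrary to [eval_eq1_absurd]. *)
Lemma zeros_project_onto n (P : PolT C n.+1 -> Prop) (g : {poly PolT C n}) z :
  ideal P -> P g -> g \is monic -> zeros (ctr P) z ->
  exists t, zeros P (upd z n t).
Proof.
move=> iP Pg gm Pz; pose m := map_poly (ev n z).
have mg0 : m g != 0.
  rewrite map_poly_eq0_id0 ?monic_neq0 // (monicP gm) rmorph1 oner_neq0 //.
pose E k := `[< exists h, [/\ P h, m h != 0 & size (m h) = k] >].
have exE : exists k, E k by exists (size (m g)); apply/asboolP; exists g.
case: (ex_minnP exE) => k /asboolP[h0 [Ph0 mh0 <-]] kmin.
have dvd h : P h -> m h0 %| m h.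
  move=> Ph; apply/modp_eq0P/eqP; apply: contraT => r0.
  pose h' := h - map_poly (cst C n) (m h %/ m h0) * h0.
  have mE : m h' = m h %% m h0.
    rewrite /m rmorphB rmorphM /= map_evK -/m {1}(divp_eq (m h) (m h0)).
    by rewrite addrC addKr.
  have /kmin : E (size (m h')).
    apply/asboolP; exists h'; split=> //; last by rewrite mE.
    by apply: idealB => //; apply: idealMl.
  by rewrite leqNgt mE ltn_modp mh0.
have [|/closed_rootP[t h0t]] := eqVneq (size (m h0)) 1%N; last first.
  exists t => h /dvd h0h; rewrite evS_upd.
  by rewrite -/m -(divpK h0h) hornerM (rootP h0t) mulr0.
move/eqP/size_poly1P => [c c0 hc].
case: (@eval_eq1_absurd n P g (map_poly (cst C n) c^-1%:P * h0) z) => //.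
  by apply: idealMl.
by rewrite rmorphM /= map_evK -/m hc -polyCM mulVf.
Qed.

Lemma root_bound (f : {poly C}) t : f \is monic -> root f t ->
  `|t| <= 1 + \sum_(i < (size f).-1) `|f`_i|.
Proof.
move=> fm /rootP ft; set S := \sum_(i < _) _.
have S0 : 0 <= S by apply: sumr_ge0.
have [t1|t1] := real_leP (normr_real t) (@real1 C).
  by apply: le_trans t1 _; rewrite lerDl.
have sf : (size f).-1.+1 = size f by rewrite prednK // lt0n size_poly_eq0 monic_neq0.
case D : (size f).-1 => [|d].
  move: ft; rewrite horner_coef -sf D big_ord1 expr0 mulr1.
  have -> : f`_0 = 1 by rewrite -(monicP fm) lead_coefE D.
  by move/eqP; rewrite oner_eq0.
have t0 : 0 < `|t| by apply: lt_trans t1.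
have : `|t| ^+ d.+1 <= S * `|t| ^+ d.
  have -> : `|t| ^+ d.+1 = `|\sum_(i < d.+1) f`_i * t ^+ i|.
    have := ft; rewrite horner_coef -sf D big_ord_recr /=.
    have -> : f`_d.+1 = 1 by rewrite -(monicP fm) lead_coefE D.
    by rewrite mul1r -normrX => /eqP; rewrite addrC addr_eq0 => /eqP ->; rewrite normrN.
  rewrite /S D mulr_suml; apply: le_trans (ler_norm_sum _ _ _) _.
  apply: ler_sum => i _; rewrite normrM normrX ler_wpM2l //.
  by rewrite ler_weXn2l ?(ltW t1) // -ltnS.
rewrite exprS ler_pM2r ?exprn_gt0 // => h.
by apply: le_trans h _; rewrite lerDr.
Qed.

End Elimination.

Lemma prime_preimage (A B : comNzRingType) (s : {rmorphism A -> B}) (P : B -> Prop) :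
  prime_ideal P -> prime_ideal (fun h => P (s h)).
Proof.
move=> pP; split; last 2 first.
- by rewrite rmorph1; case: pP.
- by move=> x y; rewrite rmorphM; case: pP => _ _; apply.
split; first by rewrite rmorph0; apply: ideal0.
  by move=> x y ? ?; rewrite rmorphD; apply: idealD.
by move=> a x ?; rewrite rmorphM; apply: idealMl.
Qed.

Section Isolated.
Variable C : numClosedFieldType.
Implicit Types (z p : nat -> C).
Local Notation ctr P := (contract (R := PolT C _) P).

Lemma near_ext n z z' (Q : (nat -> C) -> Prop) :
  (forall i, (i < n)%N -> z i = z' i) -> nearby n z Q -> nearby n z' Q.
Proof.
move=> zz' [d d0 dQ]; exists d => // w wz; apply: dQ => i lin.
by rewrite zz' // wz.
Qed.

Definition isolated_only n (P : PolT C n -> Prop) p :=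
  nearby n p (fun z => zeros P z -> forall i, (i < n)%N -> z i = p i) ->
  forall z, zeros P z -> forall i, (i < n)%N -> z i = p i.

(** The monic g bounds the roots over z near p by B. For t of modulus at most B, the values of h
    over z and over p are close, and the latter is k (t - p_n)^N, which forces t to be close to
    p_n. *)
Lemma fibre_bound n (P : PolT C n.+1 -> Prop) (g h : {poly PolT C n}) p (k e : C) N :
  P g -> g \is monic -> P h -> k != 0 ->
  map_poly (ev n p) h = k *: ('X - (p n)%:P) ^+ N -> 0 < e ->
  nearby n p (fun z => forall t, zeros P (upd z n t) -> `|t - p n| < e).
Proof.
move=> Pg gm Ph k0 hE e0.
pose B := 1 + \sum_(i < (size g).-1) (`|ev n p g`_i| + 1).
have B0 : 0 <= B by rewrite addr_ge0 ?sumr_ge0 // => i _; rewrite addr_ge0.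
pose S := \sum_(i < size h) B ^+ i.
have S0 : 0 <= S by apply: sumr_ge0 => i _; rewrite exprn_ge0.
have S1 : 0 < S + 1 by rewrite ltr_wpDl.
pose eta := `|k| * e ^+ N / (S + 1).
have keN : 0 < `|k| * e ^+ N by rewrite mulr_gt0 ?exprn_gt0 ?normr_gt0.
have eta0 : 0 < eta by rewrite divr_gt0.
have cc (r : PolT C n) := cont_ev (F := id) r (fun i ik => cont_proj p ik).
have n1 := near_forall (k := (size g).-1) (fun i _ => cc g`_i 1 ltr01).
have n2 := near_forall (k := size h) (fun i _ => cc h`_i eta eta0).
apply: nearW (nearI n1 n2) _ => z [gz hz] t Pzt.
have tB : `|t| <= B.
  have gzm : map_poly (ev n z) g \is monic by apply: monic_map.
  have sgz : size (map_poly (ev n z) g) = size g.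
    by rewrite size_map_poly_id0 // (monicP gm) rmorph1 oner_neq0.
  have /(root_bound gzm) : root (map_poly (ev n z) g) t.
    by apply/rootP; rewrite -evS_upd; apply: Pzt.
  move=> /le_trans; apply; rewrite sgz lerD2l; apply: ler_sum => i _.
  rewrite coef_map -lerBlDl; apply: le_trans (lerB_dist _ _) _.
  by apply/ltW/gz.
have hzt : (map_poly (ev n z) h).[t] = 0 by rewrite -evS_upd; apply: Pzt.
have sz z' : (size (map_poly (ev n z') h) <= size h)%N by apply: size_poly.
have hp : `|k * (t - p n) ^+ N| < `|k| * e ^+ N.
  have -> : k * (t - p n) ^+ N = (map_poly (ev n p) h).[t] - (map_poly (ev n z) h).[t].
    by rewrite hzt subr0 hE hornerZ horner_exp hornerXsubC.
  rewrite !(horner_coef_wide _ (sz _)) -sumrB.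
  apply: le_lt_trans (ler_norm_sum _ _ _) _.
  apply: (@le_lt_trans _ _ (eta * S)); last first.
    by rewrite /eta mulrAC ltr_pdivrMr // ltr_pM2l // ltrDl.
  rewrite /S mulr_sumr; apply: ler_sum => i _.
  rewrite !coef_map -mulrBl normrM distrC normrX ler_pM ?exprn_ge0 //.
    by apply/ltW/hz.
  by rewrite lerXn2r ?nnegrE.
move: hp; rewrite normrM ltr_pM2l ?normr_gt0 // normrX.
rewrite !real_ltNge ?normr_real ?rpredX ?normr_real ?(gtr0_real e0) //.
by apply: contraNN => h1; rewrite lerXn2r ?nnegrE // ltW.
Qed.

(** Over p the polynomials f and g share no root but p_n, so Bezout combines them into h in P
    specialising to a constant times a power of X - p_n. Fibres near p then stay near p_n, so p is
    isolated in the projection as well; the projection is a point by hypothesis, and its fibre holds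
    only p_n. *)
Lemma isolated_only_fibre n (P : PolT C n.+1 -> Prop) (f g : {poly PolT C n}) p :
  prime_ideal P -> zeros P p -> P f -> P g -> g \is monic ->
  (forall t, ev n.+1 (upd p n t) f = 0 -> ev n.+1 (upd p n t) g = 0 -> t = p n) ->
  isolated_only (ctr P) p -> isolated_only P p.
Proof.
move=> pP Pp Pf Pg gm fg IH [e e0 eP].
pose m : {rmorphism {poly PolT C n} -> {poly C}} := map_poly (ev n p).
pose L : {rmorphism {poly C} -> {poly PolT C n}} := map_poly (cst C n).
have mL q : m (L q) = q by apply: map_evK.
have gp0 : gcdp (m f) (m g) != 0.
  have mg0 : m g != 0 by rewrite monic_neq0 //; apply: monic_map.
  by rewrite gcdp_eq0 negb_and mg0 orbT.
have [[u v] /= uv] := Bezoutp (m f) (m g).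
pose h := L u * f + L v * g.
have Ph : P h by apply: idealD => //; apply: idealMl.
have mh : m h = u * m f + v * m g by rewrite rmorphD !rmorphM !mL.
have mh0 : m h != 0 by rewrite mh -size_poly_eq0 (eqp_size uv) size_poly_eq0.
have [r rE] := closed_field_poly_normal (m h).
have hE : m h = lead_coef (m h) *: ('X - (p n)%:P) ^+ size r.
  rewrite [LHS]rE; congr (_ *: _).
  have rr t : t \in r -> t = p n.
    move=> tr; have : root (m h) t.
      by rewrite rE rootZ ?root_prod_XsubC // lead_coef_eq0.
    by rewrite mh (eqp_root uv) root_gcd => /andP[/rootP ft /rootP gt]; apply: fg; rewrite evS_upd.
  elim: r {rE} rr => [|t r IHr] rr; first by rewrite big_nil.
  rewrite big_cons /= exprS IHr => [|s sr]; last by apply: rr; rewrite in_cons sr orbT.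
  by rewrite (rr t (mem_head _ _)).
have lh0 : lead_coef (m h) != 0 by rewrite lead_coef_eq0.
have nfb := fibre_bound Pg gm Ph lh0 hE e0.
have iso' : nearby n p (fun z => zeros (ctr P) z -> forall i, (i < n)%N -> z i = p i).
  apply: nearW (nearI nfb (near_ball n p e0)) _ => z [zb ze] Pz i lin.
  have [t Pt] := zeros_project_onto (prime_ideal_ideal pP) Pg gm Pz.
  have := eP (upd z n t) _ Pt i (ltnW lin); rewrite upd_lt //; apply.
  move=> j; rewrite ltnS leq_eqVlt => /orP[/eqP ->|ljn]; first by rewrite updE; apply: zb.
  by rewrite upd_lt //; apply: ze.
move=> z Pz; have zp := IH iso' z (zeros_contract Pz).
move=> i; rewrite ltnS leq_eqVlt => /orP[/eqP ->|lin]; last exact: zp.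
have ext q : P q -> ev n.+1 (upd p n (z n)) q = 0.
  move=> /Pz <-; apply: ev_ext => j; rewrite ltnS leq_eqVlt => /orP[/eqP ->|ljn].
    by rewrite updE.
  by rewrite upd_lt // zp.
by apply: fg; apply: ext.
Qed.

Lemma isolated_only_shear n (P : PolT C n.+1 -> Prop) phi p :
  let P' h := P (shear n (fun i => - phi i) h) in
  isolated_only P' (shear_pt n (fun i => - phi i) p) -> isolated_only P p.
Proof.
move=> P' NI iso z Pz i lin.
have P'z w : zeros P w -> zeros P' (shear_pt n (fun i => - phi i) w).
  move=> Pw h P'h; rewrite -ev_shear; exact: Pw.
have Pz' w : zeros P' w -> zeros P (shear_pt n phi w).
  by move=> P'w h Ph; rewrite -ev_shear; apply: P'w; rewrite /P' shearK.
have : nearby n.+1 (shear_pt n (fun i => - phi i) p) (fun w => zeros P (shear_pt n phi w) ->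
    forall i, (i < n.+1)%N -> shear_pt n phi w i = p i).
  apply: (near_comp (F := shear_pt n phi) (Q := fun z => zeros P z ->
    forall i, (i < n.+1)%N -> z i = p i)).
    by move=> j _; apply: (cont_ev (F := id)) => l; apply: cont_proj.
  by apply: near_ext iso => j jn; rewrite shear_ptNK.
move=> iso'; have {}NI : forall w, zeros P' w -> forall i, (i < n.+1)%N ->
    w i = shear_pt n (fun i => - phi i) p i.
  apply: NI; apply: nearW iso' _ => w h /Pz'/h wp j jn.
  rewrite -(shear_ptK phi w jn); apply: ev_ext => l; exact: wp.
rewrite -(shear_ptNK phi z lin) -(shear_ptNK phi p lin).
apply: ev_ext => l; exact: NI (P'z _ Pz) l.
Qed.

End Isolated.

Section NoIsolatedPoints.
Variable C : numClosedFieldType.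
Implicit Types (z p : nat -> C).
Local Notation ctr P := (contract (R := PolT C _) P).

Lemma monic_of_lead n (P : PolT C n.+1 -> Prop) (f : {poly PolT C n}) (k : C) :
  ideal P -> P f -> k != 0 -> lead_coef f = cst C n k ->
  exists g : {poly PolT C n}, [/\ P g, g \is monic &
    forall z, ev n.+1 z g = 0 -> ev n.+1 z f = 0].
Proof.
move=> iP Pf k0 fk; exists ((cst C n k^-1)%:P * f); split; first exact: idealMl.
  by rewrite monicE lead_coefM lead_coefC fk -rmorphM mulVf // rmorph1.
move=> z /eqP; rewrite rmorphM evC ev_cst mulf_eq0 invr_eq0 (negPf k0) /=.
by move/eqP.
Qed.

(** The minimal F divides f up to a power of its leading coefficient, so by Gauss' lemma it may be
    taken monic. As the contraction is 0, every nearby base point lifts, and continuity of roots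
    gives zeros near p with another z_0; when n = 0 the zero set is a point. *)
Lemma isolated_only_hypersurface n (P : PolT C n.+1 -> Prop) (f : {poly PolT C n}) p :
  prime_ideal P -> zeros P p -> P f -> f \is monic ->
  (forall r, ctr P r -> r = 0) -> isolated_only P p.
Proof.
move=> pP Pp Pf fm ctr0.
have [fP|[F aF]] := @one_level (PolT C n) P pP.
  have := ctr0 _ (fP f Pf (size f).-1); rewrite -lead_coefE (monicP fm) => /eqP.
  by rewrite oner_eq0.
have [k [q [r [E rP]]]] := algebraic_level_div pP aF Pf.
have r0 : r = 0 by apply/polyP => i; rewrite coef0; apply: ctr0.
have [PF nl Fmin] := aF.
have [|||F' FE] := @gauss C n q F f k 1; rewrite ?oner_neq0 ?rmorph1 //.
- exact/monicP.
- by rewrite E r0 addr0.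
have PF' : P F'.
  by apply: (prime_cancel pP nl); rewrite mul_polyC -FE.
have lF0 : lead_coef F != 0.
  by apply: contra_notN nl => /eqP ->; apply: ideal0 (contract_ideal pP).
have F'm : lead_coef F' = 1.
  by have := congr1 lead_coef FE; rewrite lead_coefZ -[LHS]mulr1 => /(mulfI lF0).
have aF' : algebraic_level (R := PolT C n) P F'.
  split=> //; first by rewrite F'm; case: (contract_prime pP).
  by move=> h Ph sh; apply: Fmin => //; rewrite FE size_scale.
case: n P f p pP Pp Pf fm ctr0 F q r k E rP r0 aF PF nl Fmin F' FE PF' lF0 F'm aF' =>
  [|n] P f p pP Pp _ _ ctr0 _ _ _ _ _ _ _ _ _ _ _ F' _ PF' _ F'm aF'.
  have /zeros_point[a aP] : point_ideal P.
    apply: (point_ideal_algebraic pP aF'); exists (fun=> 0) => r /= r0.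
    have {r0}-> : r = 0 by [].
    exact: ideal0 (contract_ideal pP).
  by move=> _ z Pz i i1; rewrite (aP z) // (aP p).
move=> [e e0 eP].
have lp : ev n.+1 p (lead_coef F') != 0 by rewrite F'm rmorph1 oner_neq0.
have [d d0 dP] := zeros_lift pP aF' e0 Pp lp.
have [e' [e'0 e'e e'd]] := pos_min e0 d0.
have e20 : 0 < e' / 2%:R by rewrite divr_gt0.
have e2e : e' / 2%:R < e' by rewrite [X in _ < X]splitr ltrDl.
pose z := upd p 0 (p 0%N + e' / 2%:R).
have zp i : `|z i - p i| < e'.
  rewrite /z /upd; case: eqP => [->|_]; last by rewrite subrr normr0.
  by rewrite addrC addKr gtr0_norm.
have [||t Pt te] := dP z.
- by move=> i _; apply: lt_le_trans (zp i) e'd.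
- by move=> r /ctr0 ->; rewrite rmorph0.
have : (upd z n.+1 t) 0%N = p 0%N.
  apply: eP => // i; rewrite ltnS leq_eqVlt => /orP[/eqP ->|lin].
    by rewrite updE.
  by rewrite upd_lt // (lt_le_trans (zp i)).
rewrite upd_lt // /z updE => /eqP; rewrite -subr_eq0 addrC addKr.
by rewrite gt_eqF.
Qed.

Lemma roots_list (f : {poly C}) : f != 0 -> exists s : seq C, forall t, root f t -> t \in s.
Proof.
move=> f0; have [s sE] := closed_field_poly_normal f; exists s => t.
by rewrite sE rootZ ?lead_coef_eq0 // root_prod_XsubC.
Qed.

(* g0 does not involve the last variable; the shear along the curve
   t -> (t - p_n)^e / tau^e makes it monic, and a generic tau keeps f away from
   the zeros of g0 on the line through p. *)
Lemma isolated_only_cylinder n (P : PolT C n.+1 -> Prop) (f : {poly PolT C n})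
    (g0 : PolT C n) p :
  (forall (P' : PolT C n -> Prop) p', prime_ideal P' -> zeros P' p' -> isolated_only P' p') ->
  prime_ideal P -> zeros P p -> P f -> f \is monic ->
  P (g0%:P : {poly PolT C n}) -> g0 != 0 -> isolated_only P p.
Proof.
move=> IH pP Pp Pf fm Pg0 g0n0.
have [K0 K0P] := weighted_shift_lead (cst C n) (var C n) g0n0.
have [e [k [k0 lk sk]]] := K0P K0.+1 1%N (leqnSn _) isT.
pose w i := (1 * K0.+1 ^ (n.-1 - i))%N.
have w0 i : (0 < w i)%N by rewrite /w mul1n expn_gt0.
set T := weighted_shift _ _ _ _ _ _ in lk sk.
have TE z l : (map_poly (ev n z) T).[l] = ev n (fun i => z i + l ^+ w i) g0.
  have -> : (map_poly (ev n z) T).[l] = (horner_eval l \o map_poly (ev n z)) T by [].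
  apply: hom_comp => [c|i lin] /=; first by rewrite map_polyC /= horner_evalE hornerC ev_cst.
  by rewrite rmorphD /= map_polyXn map_polyC /= horner_evalE hornerD hornerXn hornerC ev_var // addrC.
have mT0 : map_poly (ev n p) T != 0.
  have h : ev n p (lead_coef T) != 0 by rewrite lk ev_cst.
  rewrite map_poly_eq0_id0 // -lead_coef_eq0.
  by apply: contraNneq h => ->; rewrite rmorph0.
(* The parameters l at which the curve of coordinates p_i + l^(w_i) meets g0 = 0. *)
have [rs rsP] := roots_list mT0.
have fl0 z : map_poly (ev n z) f != 0 by rewrite monic_neq0 // monic_map.
have /choice[fs fsP] l : exists s : seq C, forall t,
    root (map_poly (ev n (fun i => p i + l ^+ w i)) f) t -> t \in s.
  exact: roots_list.
(* The values of tau for which a root b of f over such a parameter l satisfies (b - p_n) / tau = l;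
   the entry 0 makes tau invertible. *)
pose bad := 0 :: flatten [seq [seq (b - p n) / l | b <- fs l] | l <- rs].
have [tau taubad _] := exists_avoiding bad 0 (@ltr01 C).
move: taubad; rewrite in_cons negb_or => /andP[tau0 taubad].
pose psi i : {poly C} := (tau^-1 *: ('X - (p n)%:P)) ^+ w i.
have psiE i t : (psi i).[t] = ((t - p n) / tau) ^+ w i.
  by rewrite /psi horner_exp hornerZ hornerXsubC mulrC.
apply: (isolated_only_shear (phi := psi)).
set P' := (fun h => _); set p' := shear_pt _ _ _.
have pP' : prime_ideal P' by apply: prime_preimage.
have p'E i : (i < n.+1)%N -> p' i = p i.
  rewrite ltnS leq_eqVlt => /orP[/eqP ->|lin]; first exact: shear_ptn.
  rewrite /p' shear_pt_lt // hornerN psiE subrr mul0r expr0n.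
  by rewrite eqn0Ngt w0 subr0.
have P'z z : zeros P z -> zeros P' (shear_pt n (fun i => - psi i) z).
  by move=> Pz h P'h; rewrite -ev_shear; apply: Pz.
have Pp' : zeros P' p' by apply: P'z.
have P's h : P h -> P' (shear n psi h) by rewrite /P' shearK.
pose g : {poly PolT C n} := shear n psi (g0%:P : {poly PolT C n}).
pose l1 : {poly PolT C n} := (cst C n tau^-1)%:P * ('X - (cst C n (p n))%:P).
have sl1 : size l1 = 2.
  by rewrite /l1 mul_polyC size_scale ?size_XsubC // fmorph_eq0 invr_eq0.
have ll1 : lead_coef l1 = cst C n tau^-1.
  by rewrite /l1 lead_coefM lead_coefC lead_coefXsubC mulr1.
have gE : g = T \Po l1.
  apply: (@ev_inj C n.+1) => z; rewrite /g ev_shear [LHS]evC evS map_comp_poly horner_comp TE.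
  apply: ev_ext => i lin; rewrite shear_pt_lt // psiE; congr (_ + _ ^+ _).
  rewrite rmorphM rmorphB /= map_polyX !map_polyC /= !ev_cst.
  by rewrite hornerM hornerXsubC hornerC mulrC.
have lg : lead_coef g = cst C n (k * tau^-1 ^+ (size T).-1).
  by rewrite gE lead_coef_comp ?sl1 // lk ll1 -rmorphXn -rmorphM.
have [|g1 [P'g1 g1m g1g]] := monic_of_lead (prime_ideal_ideal pP') (P's _ Pg0) _ lg.
  by rewrite mulf_neq0 // expf_neq0 // invr_eq0.
apply: (isolated_only_fibre (f := shear n psi f) pP' Pp' (P's _ Pf) P'g1 g1m); last first.
  by apply: IH; [apply: contract_prime|apply: zeros_contract].
move=> t ft /g1g; rewrite (p'E n) //.
pose l := (t - p n) / tau.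
have ptE i : (i < n)%N -> shear_pt n psi (upd p' n t) i = p i + l ^+ w i.
  by move=> lin; rewrite shear_pt_lt // psiE updE upd_lt // p'E // ltnW.
rewrite ev_shear evC (ev_ext (z' := fun i => p i + l ^+ w i)) // => gl.
have lrs : l \in rs by apply: rsP; apply/rootP; rewrite TE.
move: ft; rewrite ev_shear evS shear_ptn updE.
rewrite (_ : map_poly _ f = map_poly (ev n (fun i => p i + l ^+ w i)) f); last first.
  by apply: eq_map_poly => r; apply: ev_ext.
move=> /rootP/fsP tfs; have [l0|l0] := eqVneq l 0.
  move/eqP: l0; rewrite mulf_eq0 invr_eq0 (negPf tau0) orbF subr_eq0.
  by move/eqP.
case/negP: taubad; apply/flattenP; exists [seq (b - p n) / l | b <- fs l].
  by apply/mapP; exists l.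
apply/mapP; exists t => //; rewrite /l invfM invrK mulrA mulfV ?mul1r //.
by apply: contraNneq l0 => tp; rewrite /l tp mul0r.
Qed.

(** Induction on the number of variables. If P is 0 no zero is isolated; otherwise a shear gives P a
    monic member, and the case is that of a cylinder when the contraction is nonzero, of a
    hypersurface when it is 0. *)
Theorem isolated_zero_only n (P : PolT C n -> Prop) p :
  prime_ideal P -> zeros P p -> isolated_only P p.
Proof.
elim: n P p => [|n IH] P p pP Pp; first by move=> _ z _ i.
have [[f Pf f0]|P0] := EM (exists2 f, P f & f != 0); last first.
  move=> [e e0 eP]; have e20 : 0 < e / 2%:R by rewrite divr_gt0.
  have : upd p n (p n + e / 2%:R) n = p n.
    apply: eP => // [i _|h Ph].
      rewrite /upd; case: eqP => [->|_]; last by rewrite subrr normr0.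
      by rewrite addrC addKr gtr0_norm // [X in _ < X]splitr ltrDl.
    suff -> : h = 0 by rewrite rmorph0.
    by apply/eqP; apply: contraT => h0; case: P0; exists h.
  by rewrite updE => /eqP; rewrite -subr_eq0 addrC addKr gt_eqF.
have [phi [k [k0 lk]]] := shear_monic f0.
apply: (isolated_only_shear (phi := phi)).
set P' := (fun h => _); set p' := shear_pt _ _ _.
have pP' : prime_ideal P' by apply: prime_preimage.
have Pp' : zeros P' p' by move=> h P'h; rewrite -ev_shear; apply: Pp.
have P'f : P' (shear n phi f) by rewrite /P' shearK.
have [g [P'g gm _]] := monic_of_lead (prime_ideal_ideal pP') P'f k0 lk.
have [[g0 P'g0 g00]|P0] := EM (exists2 g0, ctr P' g0 & g0 != 0).
  exact: (isolated_only_cylinder IH pP' Pp' P'g gm P'g0 g00).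
apply: (isolated_only_hypersurface pP' Pp' P'g gm) => r P'r.
by apply/eqP; apply: contraT => r0; case: P0; exists r.
Qed.

End NoIsolatedPoints.

(** * Algebraic sets in the sense of the definitions *)

Local Open Scope classical_set_scope.

Section Points.
Variables (R : realType) (n : nat).
Local Notation C := (Cplx R).
Local Notation Cn := 'rV[C]_n.
Implicit Types (z : Cn) (u : nat -> C) (W V : set Cn).

(** Bridge from row vectors to sequences; the default 0 beyond n is never seen by [ev n]. *)
Definition pt z (i : nat) : C := if insub i is Some j then z 0 (j : 'I_n) else 0.

Definition rv u : Cn := \row_(i < n) u i.

Lemma ptE z (i : 'I_n) : pt z i = z 0 i.
Proof. by rewrite /pt valK. Qed.

Lemma ptK z : rv (pt z) = z.
Proof. by apply/rowP => i; rewrite mxE ptE. Qed.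

Lemma rvK u i : (i < n)%N -> pt (rv u) i = u i.
Proof. by move=> lin; have := ptE (rv u) (Ordinal lin); rewrite mxE. Qed.

Lemma ev_rv u (p : PolT C n) : ev n (pt (rv u)) p = ev n u p.
Proof. by apply: ev_ext => i; apply: rvK. Qed.

Lemma near_nbhs z (Q : (nat -> C) -> Prop) :
  nearby n (pt z) Q -> nbhs z [set z' | Q (pt z')].
Proof.
move=> [d d0 dQ]; apply/nbhs_ballP; exists d => //= w zw /=.
apply: dQ => i lin; case: zw => _ /(_ 0 (Ordinal lin)).
by rewrite -ball_normE /= distrC -!ptE.
Qed.

Lemma nbhs_near z (Q : set Cn) : nbhs z Q -> nearby n (pt z) (fun u => Q (rv u)).
Proof.
move=> /nbhs_ballP[d /= d0 dQ]; exists d => // u uz; apply: dQ.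
split=> // i j.
by rewrite ord1 mxE -ball_normE /= distrC -ptE; apply: uz.
Qed.

Lemma mpoly_to_PolT (p : mpoly.mpoly n C) : exists q : PolT C n,
  forall z, ev n (pt z) q = mpoly.meval (fun i => z 0 i) p.
Proof.
elim/mpoly.mpolyind: p => [|c m p _ _ [q qE]].
  by exists 0 => z; rewrite rmorph0 mpoly.meval0.
exists (cst C n c * \prod_(i < n) var C n i ^+ (mpoly.fun_of_multinom m i) + q) => z.
rewrite rmorphD rmorphM ev_cst rmorph_prod mpoly.mevalD mpoly.mevalZ qE.
congr (_ * _ + _); rewrite mpoly.mevalX; apply: eq_bigr => i _.
by rewrite rmorphXn ev_var // ptE.
Qed.

(* [mpoly] is not imported, hence the explicit name of its ring structure. *)
Lemma PolT_to_mpoly (q : PolT C n) : exists p : mpoly.mpoly n C,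
  forall z, mpoly.meval (fun i => z 0 i) p = ev n (pt z) q.
Proof.
pose A : comNzRingType := mpoly.mpoly_mpoly__canonical__GRing_ComNzRing n C.
suff H k (r : PolT C k) : (k <= n)%N -> exists p : mpoly.mpoly n C,
    forall z, mpoly.meval (fun i => z 0 i) p = ev k (pt z) r.
  exact: H.
elim: k r => [|k IH] r kn.
  by exists (mpoly.mpolyC n (r : C)) => z; rewrite mpoly.mevalC.
elim/poly_ind: r => [|r c [p1 p1E]].
  by exists (mpoly.mpolyC n (0 : C)) => z; rewrite mpoly.mevalC rmorph0.
have [p2 p2E] := IH c (ltnW kn).
exists ((p1 : A) * (mpoly.mpolyX C (mpoly.mnm1 (Ordinal kn)) : A) + (p2 : A)) => z.
rewrite evMXaddC -p1E -p2E; apply: etrans (mpoly.mevalD _ _ _) _; congr (_ + _).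
apply: etrans (mpoly.mevalM _ _ _) _; congr (_ * _).
by rewrite mpoly.mevalXU -ptE.
Qed.

Definition ideal_of W : PolT C n -> Prop := vanish (fun u => W (rv u)).

Lemma ideal_ofP W q : ideal_of W q <-> forall z, W z -> ev n (pt z) q = 0.
Proof.
split=> [Wq z Wz|Wq u /Wq]; first by apply: Wq; rewrite ptK.
by rewrite ev_rv.
Qed.

Lemma algebraic_zeros W u : algebraic W -> zeros (ideal_of W) u -> W (rv u).
Proof.
move=> [P ->] Pu p Pp; have [q qE] := mpoly_to_PolT p.
rewrite -qE ev_rv; apply: Pu; apply/ideal_ofP => z Wz.
by rewrite qE; apply: Wz.
Qed.

Lemma algebraic_setI_zero W (f : PolT C n) : algebraic W ->
  algebraic (W `&` [set z | ev n (pt z) f = 0]).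
Proof.
move=> [P ->]; have [p pE] := PolT_to_mpoly f.
exists (P `|` [set p]); apply/seteqP; split=> z.
  by move=> [Wz /= fz] q [/Wz //|->]; rewrite pE.
move=> Wz; split; first by move=> q Pq; apply: Wz; left.
by rewrite /= -pE; apply: Wz; right.
Qed.

(** If f g vanishes on V, then V is the union of its intersections with f = 0 and with g = 0. *)
Lemma irreducible_prime V : irreducible_algebraic V -> prime_ideal (ideal_of V).
Proof.
move=> [aV [z0 Vz0] irr]; split; first exact: vanish_ideal.
  by move/ideal_ofP/(_ z0 Vz0)/eqP; rewrite rmorph1 oner_eq0.
move=> f g /ideal_ofP fg.
have [|Vf|Vg] := irr _ _ (algebraic_setI_zero f aV) (algebraic_setI_zero g aV).
- apply/seteqP; split=> z; last by move=> [[]|[]].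
  move=> Vz; have /eqP := fg z Vz; rewrite rmorphM mulf_eq0.
  by case/orP => /eqP; [left|right].
- by left; apply/ideal_ofP => z; rewrite Vf => -[].
- by right; apply/ideal_ofP => z; rewrite Vg => -[].
Qed.

End Points.

(** * Compactness and finiteness of slices *)

Import Normc.

Section Compactness.
Variables (R : realType).
Local Notation C := (Cplx R).

Lemma normE (x : C) : `|x| = ((normc x)%:C)%C.
Proof. by []. Qed.

Lemma normc_lt (x : C) (a : R) : (`|x| < (a%:C)%C) = (normc x < a).
Proof. by rewrite normE ltcR. Qed.

Lemma normc_le (x : C) (a : R) : (`|x| <= (a%:C)%C) = (normc x <= a).
Proof. by rewrite normE lecR. Qed.

Lemma pos_real (e : C) : 0 < e -> exists2 a : R, 0 < a & e = (a%:C)%C.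
Proof.
move=> e0; pose a : R := complex.Re (e : R[i]).
have ae : (a%:C)%C = e :> R[i] by apply: RRe_real; apply: gtr0_real.
by exists a => //; rewrite -ltcR ae.
Qed.

Lemma normc_dist (x y : C) : `|normc x - normc y| <= normc (x - y).
Proof.
have h (a b : C) : normc a - normc b <= normc (a - b).
  by rewrite lerBlDr; have := le_normcD (a - b) b; rewrite subrK.
have hs (a b : C) : normc (a - b) = normc (b - a).
  by apply: (@complexI R); rewrite -!normE distrC.
by rewrite ler_norml h andbT lerNl opprB hs.
Qed.

Lemma normc_real (a : R) : normc ((a%:C)%C : C) = `|a|.
Proof. by rewrite /= expr0n addr0 sqrtr_sqr. Qed.

Lemma Re_le_normc (x : R[i]) : `|complex.Re x| <= normc x.
Proof. by case: x => a b /=; rewrite -sqrtr_sqr ler_wsqrtr // lerDl sqr_ge0. Qed.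

Lemma Im_le_normc (x : R[i]) : `|complex.Im x| <= normc x.
Proof. by case: x => a b /=; rewrite -sqrtr_sqr ler_wsqrtr // lerDr sqr_ge0. Qed.

Lemma real_complex_continuous : continuous (fun a : R => (a%:C)%C : C).
Proof.
move=> a; apply/cvgrPdist_lt => e /pos_real[d d0 ->].
near=> b; rewrite -rmorphB normc_lt normc_real.
near: b; apply/nbhs_ballP; exists d => //= b; by rewrite -ball_normE.
Unshelve. all: by end_near. Qed.

(** A square rather than the disc: it is a continuous image of a product of segments, and any
    compact set containing the disc suffices. *)
Definition box : set C :=
  (fun x : R * R => (x.1%:C)%C + 'i%C * (x.2%:C)%C) @` (`[-1, 1]%classic `*` `[-1, 1]%classic).

Lemma box_compact : compact box.
Proof.
apply: continuous_compact; last by apply: compact_setX; apply: segment_compact.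
apply: continuous_subspaceT => x; apply: cvgD.
  apply: (@cvg_comp _ _ _ fst (fun a : R => (a%:C)%C : C)); first exact: cvg_fst.
  exact: real_complex_continuous.
apply: cvgM; first exact: cvg_cst.
apply: (@cvg_comp _ _ _ snd (fun a : R => (a%:C)%C : C)); first exact: cvg_snd.
exact: real_complex_continuous.
Qed.

Lemma disc_box (x : R[i]) : normc x <= 1 -> box x.
Proof.
move=> x1; exists (complex.Re x, complex.Im x); last by rewrite [RHS]complexE.
by split=> /=; rewrite in_itv /= -ler_norml;
  [apply: le_trans (Re_le_normc x) x1|apply: le_trans (Im_le_normc x) x1].
Qed.

Section Polynomials.
Variable n : nat.
Local Notation Cn := 'rV[C]_n.

Lemma normc_ev_continuous (p : PolT C n) :
  continuous (fun z : Cn => normc (ev n (pt z) p)).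
Proof.
move=> z A /nbhs_ballP[e /= e0 eA].
have eC : 0 < (e%:C)%C :> C by rewrite ltcR.
have := near_nbhs (cont_ev (F := id) p (fun i ik => cont_proj (pt z) ik) eC).
apply: (@filterS _ (nbhs z) (nbhs_filter z)) => w /=; rewrite normc_lt => h.
apply: eA; rewrite -ball_normE /= distrC.
exact: le_lt_trans (normc_dist _ _) h.
Qed.

Lemma closed_normc_le (p : PolT C n) (a : R) :
  closed [set z : Cn | normc (ev n (pt z) p) <= a].
Proof.
apply: (@closed_comp _ _ (fun z : Cn => normc (ev n (pt z) p)) [set x : R | x <= a]).
  by move=> z _; apply: normc_ev_continuous.
exact: closed_le.
Qed.

Lemma compact_zeros (J : PolT C n -> Prop) :
  compact [set z : Cn | zeros J (pt z) /\ forall i, normc (z 0 i) <= 1].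
Proof.
apply: (@subclosed_compact _ _ [set v : Cn | forall i, box (v ord0 i)]).
- have -> : [set z : Cn | zeros J (pt z) /\ forall i, normc (z 0 i) <= 1] =
     \bigcap_(h in [set h | J h]) [set z : Cn | normc (ev n (pt z) h) <= 0] `&`
     \bigcap_(i in [set: 'I_n]) [set z : Cn | normc (ev n (pt z) (var C n i)) <= 1].
    apply/seteqP; split=> z [h1 h2]; split.
    + by move=> h Jh /=; rewrite (h1 _ Jh) normc0.
    + by move=> i _ /=; rewrite ev_var // ptE; apply: h2.
    + move=> h /h1 /=; rewrite -normc_le normr_le0 => /eqP; exact.
    + by move=> i; have := h2 i I; rewrite /= ev_var // ptE.
  by apply: closedI; apply: closed_bigI => ? _; apply: closed_normc_le.
- by apply: (@rV_compact _ n (fun=> box)) => i; exact: box_compact.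
- by move=> z [_ h] i; apply: disc_box; apply: h.
Qed.

Lemma closed_polydisc (z : Cn) : (forall i, normc (z 0 i) <= 1) ->
  closure (@polydisc R n) z.
Proof.
move=> z1 B /nbhs_near[e e0 eB].
have [d [d0 d1 de]] := @pos_min _ 1 e ltr01 e0.
pose t : C := 1 - d / 2%:R.
have d20 : 0 < d / 2%:R by rewrite divr_gt0.
have d21 : d / 2%:R < 1.
  by apply: lt_le_trans d1; rewrite [X in _ < X]splitr ltrDl.
have t0 : 0 <= t by rewrite subr_ge0 ltW.
exists (rv n (fun i => t * pt z i)); split.
  move=> i; rewrite mxE ptE normrM ger0_norm //.
  have zi : `|z 0 i| <= 1 by rewrite -[1]/((1 : R)%:C)%C normc_le.
  apply: (@le_lt_trans _ _ (t * 1)); first exact: ler_wpM2l.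
  by rewrite mulr1 /t ltrBlDr ltrDl.
apply: eB => i lin.
have zi : `|pt z i| <= 1.
  by have := z1 (Ordinal lin); rewrite -normc_le -ptE.
have -> : t * pt z i - pt z i = - (d / 2%:R * pt z i).
  by rewrite /t mulrBl mul1r addrAC subrr sub0r.
rewrite normrN normrM gtr0_norm //.
apply: (@le_lt_trans _ _ (d / 2%:R * 1)); first by apply: ler_wpM2l => //; apply: ltW.
by rewrite mulr1; apply: lt_le_trans de; rewrite [X in _ < X]splitr ltrDl.
Qed.

End Polynomials.

(** A point of the slice in the closed polydisc but not in the open one would lie on the torus,
    forcing |a| = 1. The slice in the open polydisc is thus compact, and the extreme value theorem
    supplies the hypothesis of [compact_zeros_finite]. *)
Theorem slice_finite n (W : set 'rV[C]_n.+1) (a : C) : algebraic W ->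
  W `&` @bd_polydisc R n.+1 = W `&` @torus R n.+1 -> `|a| < 1 ->
  fin_pts n.+1 (fun u => [/\ W (rv n.+1 u), u 0%N = a & forall i, (i < n.+1)%N -> `|u i| < 1]).
Proof.
move=> aW bdW a1.
pose W1 := W `&` [set z | ev n.+1 (pt z) (var C n.+1 0 - cst C n.+1 a) = 0].
have aW1 : algebraic W1 by apply: algebraic_setI_zero.
pose D (u : nat -> C) := forall i, (i < n.+1)%N -> `|u i| < 1.
apply: (@fin_ptsS _ _ _ (fun u => zeros (ideal_of W1) u /\ D u)).
  move=> u [Wu ua Du]; split=> //; apply: zeros_vanish; split=> //; rewrite /mkset.
  by rewrite ev_rv rmorphB ev_var // ev_cst ua subrr.
apply: compact_zeros_finite.
  move=> u Du; apply: near_forall => i lin.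
  have e0 : 0 < 1 - `|u i| by rewrite subr_gt0 Du.
  apply: nearW (cont_proj u lin e0) _ => v; rewrite ltrBrDr => /(le_lt_trans _); apply.
  by have := ler_normD (v i - u i) (u i); rewrite subrK.
move=> I p I0I [u [Iu Du]].
pose K := [set z : 'rV[C]_n.+1 | zeros I (pt z) /\ forall i, normc (z 0 i) <= 1].
have KD z : K z -> D (pt z).
  move=> [Iz z1]; have : W1 z.
    by rewrite -(ptK z); apply: (algebraic_zeros aW1) => h /I0I/Iz.
  move=> [Wz]; rewrite /mkset rmorphB ev_var // ev_cst => /eqP; rewrite subr_eq0 => /eqP z0.
  suff : polydisc z by move=> h i lin; have := h (Ordinal lin); rewrite -ptE.
  apply: contrapT => nz.
  have : (W `&` @bd_polydisc R n.+1) z by split=> //; split=> //; apply: closed_polydisc.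
  rewrite bdW => -[_ /(_ ord0)]; rewrite -ptE z0 => h.
  by rewrite h ltxx in a1.
have K0 : K !=set0.
  exists (rv n.+1 u); split; first by move=> h /Iu; rewrite ev_rv.
  move=> i; rewrite mxE -normc_le; apply: ltW; exact: Du.
have [||c Kc cmax] := @compact_EVT_max _ R (fun z : 'rV[C]_n.+1 => normc (ev n.+1 (pt z) p)) K K0.
- exact: compact_zeros.
- by apply: continuous_subspaceT => z; apply: normc_ev_continuous.
move/set_mem: Kc => Kc; exists (pt c); split; [by case: Kc|exact: KD|].
move=> v Iv Dv; rewrite normE normE lecR -(ev_rv v).
apply: cmax; apply/mem_set; split; first by move=> h /Iv; rewrite ev_rv.
by move=> i; rewrite mxE -normc_le; apply: ltW; apply: Dv.
Qed.

End Compactness.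

(** * Holomorphic charts *)

Section Curves.
Variables (R : realType).
Local Notation C := (Cplx R).

Lemma nbhs0_radius (A : set C) : nbhs (0 : C) A ->
  exists2 r : C, 0 < r & forall s, `|s - 0| < r -> A s.
Proof.
move=> /nbhs_ballP[r /= r0 rA]; exists r => // s; rewrite subr0 => sr.
by apply: rA; rewrite -ball_normE /= sub0r normrN.
Qed.

Lemma ptZB n (a : C) (x y : 'rV[C]_n) i : pt (a *: (x - y)) i = a * (pt x i - pt y i).
Proof. by rewrite /pt; case: insubP => [j _ _|_]; rewrite ?mxE // subrr mulr0. Qed.

Lemma hasder_line n (g : 'rV[C]_n -> 'rV[C]_n) (w e : 'rV[C]_n) i :
  (i < n)%N -> differentiable g w ->
  hasder (fun s : C => pt (g (w + s *: e)) i) 0 (pt ('d g w e) i).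
Proof.
move=> lin dg; have dd := @diff_derivable _ _ _ g w e dg.
have cg : h^-1 *: ((g \o shift w) (h *: e) - g w) @[h --> (0 : C)^'] --> 'd g w e.
  by rewrite -(deriveE e dg); exact: dd.
pose G (s : C) := pt (g (w + s *: e)) i.
exists (fun s : C => if s == 0 then pt ('d g w e) i else s^-1 * (G s - G 0)).
  move=> s; rewrite subr0; case: eqP => [->|/eqP s0]; first by rewrite mul0r subrr.
  by rewrite mulrA mulfV // mul1r.
split; last by rewrite eqxx.
move=> eps eps0; rewrite eqxx.
have nb : nbhs ('d g w e) [set v | `|pt v i - pt ('d g w e) i| < eps].
  apply: (near_nbhs (Q := fun u => `|u i - pt ('d g w e) i| < eps)).
  by exists eps => // u; apply.
have := cg _ nb; rewrite /= /dnbhs /within /= => /nbhs_ballP[d /= d0 dP].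
exists d => // z /(_ 0%N isT); rewrite subr0 => zd.
have [_|z0] := eqVneq (z 0%N) 0; first by rewrite subrr normr0.
have := dP (z 0%N); rewrite /= sub0r normrN => /(_ zd z0).
by rewrite ptZB /G scale0r addr0 [z 0%N *: e + w]addrC.
Qed.

Lemma hasder_derivable (h : C -> C) s d : hasder h s d -> differentiable h s.
Proof.
move=> [k hE [ck kd]]; apply/derivable1_diffP.
suff : t^-1 *: ((h \o shift s) (t *: (1 : C)) - h s) @[t --> (0 : C)^'] --> (k s : C).
  by move/cvgP.
move=> A /nbhs_ballP[e /= e0 eA].
have [r r0 rP] := ck e e0.
rewrite /= /dnbhs /within /=; apply/nbhs_ballP; exists r => //= t.
rewrite /ball_ /= sub0r normrN => tr t0; apply: eA.
rewrite hE [_%:A]mulr1 addrK -ball_normE /= distrC.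
have := rP (fun=> t + s) (fun i _ => _); rewrite addrK => /(_ _)/=.
rewrite [_ *: _]mulrA mulVf // mul1r; apply => i; exact: tr.
Qed.

Lemma differentiable_row n (psi : C -> nat -> C) s :
  (forall i, (i < n)%N -> differentiable (fun s => psi s i) s) ->
  differentiable (fun s => rv n (psi s)) s.
Proof.
move=> dpsi.
have -> : (fun s => rv n (psi s)) =
    \sum_(i < n) (fun s => psi s i *: (delta_mx 0 i : 'rV[C]_n)).
  apply: funext => t; rewrite fct_sumE; apply/rowP => j.
  rewrite mxE summxE (bigD1 j) //= !mxE !eqxx mulr1 big1 ?addr0 // => i ij.
  by rewrite !mxE eqxx eq_sym (negPf ij) mulr0.
apply: differentiable_sum => i; apply: differentiableZl; exact: dpsi.
Qed.

(** The chart at p, read along complex lines in C^d x {0}. The identity f (g x) = x on them is kept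
    because it makes the differential of g injective in these directions. *)
Lemma chart_line n d (M : set 'rV[C]_n) (p : 'rV[C]_n) :
  complex_submanifold d M -> M p ->
  exists (f g : 'rV[C]_n -> 'rV[C]_n) (w : 'rV[C]_n),
    [/\ differentiable f p, differentiable g w, g w = p &
    forall e : 'rV[C]_n, (forall i : 'I_n, (d <= i)%N -> e 0 i = 0) ->
    nbhs (0 : C) [set s : C | M (g (w + s *: e)) /\ f (g (w + s *: e)) = w + s *: e]].
Proof.
move=> [dn Mc] Mp; have [U [V [f [g [Up [[oU df] [oV dg] fUV gf] MU]]]]] := Mc p Mp.
exists f, g, (f p); have Vw : V (f p) by rewrite -fUV; exists p.
split; [exact: df|exact: dg|exact: gf|move=> e e0].
have cl : (fun s : C => f p + s *: e) @ (0 : C) --> f p + (0 : C) *: e.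
  apply: (@continuousD _ _ _ (fun=> f p) (fun s : C => s *: e)).
    exact: cst_continuous.
  exact: scalel_continuous.
rewrite scale0r addr0 in cl.
have := cl V (open_nbhs_nbhs (conj oV Vw)).
apply: (@filterS _ (nbhs (0 : C)) (nbhs_filter (0 : C))) => s /=.
rewrite -{1}fUV => -[z Uz zE].
have fg : f (g (f p + s *: e)) = f p + s *: e by rewrite -zE gf.
split=> //; apply/MU; first by rewrite -zE gf.
move=> i di; rewrite fg !mxE (e0 i di) mulr0 addr0.
by apply: (proj1 (MU p Up)).
Qed.

End Curves.

(** * Upper bound for the dimension *)

Section Dimension.
Variables (R : realType) (n : nat).
Local Notation C := (Cplx R).
Local Notation Cn := 'rV[C]_n.+1.
Implicit Types (W M V : set Cn) (P : PolT C n.+1 -> Prop).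

Definition in_disc (u : nat -> C) := forall i, (i < n.+1)%N -> `|u i| < 1.

Lemma in_disc_near u : in_disc u -> nearby n.+1 u in_disc.
Proof.
move=> Du; apply: near_forall => i lin.
have e0 : 0 < 1 - `|u i| by rewrite subr_gt0 Du.
apply: nearW (cont_proj u lin e0) _ => v; rewrite ltrBrDr => /(le_lt_trans _); apply.
by have := ler_normD (v i - u i) (u i); rewrite subrK.
Qed.

Lemma in_discP (z : Cn) : in_disc (pt z) <-> polydisc z.
Proof.
split=> [h i|h i lin]; first by rewrite -ptE; apply: h.
by have := h (Ordinal lin); rewrite -ptE.
Qed.

(** Moving z_k with k > 0 while z_0 is fixed yields points of the slice through q whose k-th
    coordinate avoids any given finite list, against [slice_finite]. *)
Lemma no_lift W P c k q : algebraic W ->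
  W `&` @bd_polydisc R n.+1 = W `&` @torus R n.+1 ->
  (forall h, ideal_of W h -> P h) -> (0 < k <= n)%N -> lifts_at k P c ->
  zeros P q -> ev n.+1 q c != 0 -> in_disc q -> False.
Proof.
move=> aW bdW WP /andP[k0 kn] lP Pq cq Dq.
have [s sP] := slice_finite aW bdW (Dq 0%N isT).
have [e e0 eD] := in_disc_near Dq.
have [d d0 dP] := lP q Pq cq e e0.
have [t ts /dP[z [Pz zq zk zi]]] := exists_avoiding s (q k) d0.
case/negP: ts; rewrite -zk; apply: sP => //; split.
- by apply: (algebraic_zeros aW) => h /WP/Pz.
- exact: zi.
- by apply: eD.
Qed.

(** A relatively open piece of M with prime ideal P is chosen; curves in M through its points stay
    in the zeros of P for a while. Free variables beyond z_0 are excluded by [no_lift]; if d were at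
    least 2, rigidity would make the differential of the inverse chart kill a nonzero tangent
    direction. *)
Lemma submanifold_dim_le1 W M d : algebraic W ->
  W `&` @bd_polydisc R n.+1 = W `&` @torus R n.+1 ->
  complex_submanifold d M -> M !=set0 -> M `<=` W `&` @polydisc R n.+1 -> (d <= 1)%N.
Proof.
move=> aW bdW Md [p0 Mp0] MW; rewrite leqNgt; apply/negP => d2.
pose S_ (B : set Cn) (u : nat -> C) := M (rv n.+1 u) /\ B (rv n.+1 u).
pose F S := exists B : set Cn, [/\ open B, M `&` B !=set0 & S = S_ B].
have [| |S f g [B [oB [p [Mp Bp]] ->]] fg|S [[B [oB [p [Mp Bp]] SE]] pP _]] :=
    @prime_vanish C n.+1 F.
- exists (S_ setT), setT; split=> //; first exact: openT.
  by exists p0.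
- move=> S [B [oB [p [Mp Bp]] ->]]; exists (pt p); rewrite /S_ ptK //.
- have [h|nf] := EM (vanish (S_ B) f).
    by exists (S_ B); split=> //; [exists B; split=> //; exists p|left].
  have [u [Su fu]] : exists u, S_ B u /\ ev n.+1 u f != 0.
    apply: contrapT => h; apply: nf => u Su; apply/eqP; apply: contrapT => /negP fu.
    by apply: h; exists u.
  (* The part where f is nonzero is again relatively open, and g vanishes on it. *)
  pose B' := B `&` [set z | ev n.+1 (pt z) f != 0].
  exists (S_ B'); split.
  + exists B'; split=> //; last by exists (rv n.+1 u); case: Su => ? ?; do 2!split=> //;
      rewrite /mkset ev_rv.
    apply: openI => //; rewrite openE => z fz; rewrite /mkset in fz.
    exact: (near_nbhs (near_ev_neq0 fz)).
  + by move=> z [? []].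
  + right=> z [Mz [Bz]]; rewrite /mkset ev_rv => fz.
    have /eqP := fg z (conj Mz Bz); rewrite rmorphM mulf_eq0 (negPf fz) /=.
    by move/eqP.
set P := vanish S in pP; rewrite SE in P pP.
have [c Pc cP] := local_structure pP.
have [u [[Mu Bu] cu]] : exists u, S_ B u /\ ev n.+1 u c != 0.
  apply: contrapT => h; apply: Pc => u Su; apply/eqP; apply: contrapT => /negP cu.
  by apply: h; exists u.
case: cP => [[k kn lP]|[tP _]].
  have Du : in_disc u.
    move=> i lin; rewrite -(rvK u lin); have [_ h] := MW _ Mu.
    exact: (proj2 (in_discP _) h).
  apply: (no_lift aW bdW _ kn lP _ cu Du); last exact: zeros_vanish.
  by move=> h Wh v [Mv _]; have [Wv _] := MW _ Mv; rewrite -ev_rv (proj1 (ideal_ofP _ _) Wh).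
have n1 : (1 < n.+1)%N by case: Md => dn _; apply: leq_trans dn.
pose e0 : Cn := delta_mx 0 ord0; pose e1 : Cn := delta_mx 0 (Ordinal n1).
have lowdim a b (i : 'I_n.+1) : (d <= i)%N -> (a *: e0 + b *: e1) 0 i = 0.
  move=> di; have i2 := leq_trans d2 di.
  by rewrite !mxE -!val_eqE /= !gtn_eqF ?mulr0 ?addr0 //; apply: leq_trans i2.
have [f [g [w [df dg gw line]]]] := chart_line Md Mu.
pose L (v : Cn) : Cn := 'd g w v.
pose x := L e0 0 ord0; pose y := L e1 0 ord0.
(* Two tangent directions have a nontrivial combination whose z_0 component is 0. *)
have [a [b [ab ab0]]] : exists a b : C, a * x + b * y = 0 /\ ((a != 0) || (b != 0)).
  have [x0|xn0] := eqVneq x 0.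
    by exists 1, 0; rewrite x0 mulr0 mul0r addr0 oner_neq0.
  by exists y, (- x); rewrite mulNr [y * x]mulrC subrr oppr_eq0 xn0 orbT.
have [e eE] : exists e : Cn, e = a *: e0 + b *: e1 by exists (a *: e0 + b *: e1).
have nb : nbhs (0 : C) [set s : C | M (g (w + s *: e)) /\ f (g (w + s *: e)) = w + s *: e].
  by apply: line => i; rewrite eE; apply: lowdim.
have Le0 : L e 0 ord0 = 0.
  by rewrite /L eE linearD !linearZ /= !mxE.
have cg : (fun s : C => g (w + s *: e)) @ (0 : C) --> rv n.+1 u.
  have cw : {for (0 : C), continuous (fun s : C => w + s *: e)}.
    apply: (@continuousD _ _ _ (fun=> w) (fun s : C => s *: e)).
      exact: cst_continuous.
    exact: scalel_continuous.
  have cgw : {for w + (0 : C) *: e, continuous g}.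
    by rewrite scale0r addr0; apply: differentiable_continuous.
  have h : (fun s : C => g (w + s *: e)) @ (0 : C) --> g (w + (0 : C) *: e).
    exact: (@continuous_comp _ _ _ (fun s : C => w + s *: e) g (0 : C) cw cgw).
  by rewrite scale0r addr0 gw in h.
have nB := cg B (open_nbhs_nbhs (conj oB Bu)).
have [r r0 rP] := nbhs0_radius (filterI nb nB).
have Le i : (i < n.+1)%N -> pt (L e) i = 0.
  apply: (tP (fun s => pt (g (w + s *: e))) (pt (L e)) 0).
  - exists r => // s /rP[[Ms _] Bs]; apply: zeros_vanish.
    by split; rewrite ptK.
  - by rewrite scale0r addr0 gw ev_rv.
  - by move=> j jn; apply: hasder_line.
  - by rewrite (ptE _ ord0).
have L0 : L e = 0 by apply/rowP => i; rewrite mxE -ptE Le.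
have df' : differentiable f (g w) by rewrite gw; exact: df.
have dfg : differentiable (f \o g) w by exact: (differentiable_comp dg df').
have dfg0 : 'd (f \o g) w e = 0.
  apply: (etrans (congr1 (fun h : Cn -> Cn => h e) (diff_comp dg df'))) => /=.
  by rewrite -[X in 'd f (g w) X]/(L e) L0 linear0.
(* Along the line f o g is the identity, with derivative e, while its differential sends e to 0. *)
have ei (i : 'I_n.+1) : e 0 i = 0.
  have := hasder_line e (ltn_ord i) dfg; rewrite dfg0 => h1.
  have h2 : hasder (fun s : C => - pt w i + - pt e i * s) 0 (0 + - pt e i).
    apply: hasderD; first exact: hasder_cst.
    have := hasderM (hasder_cst (- pt e i) 0) (hasder_id (0 : C)).
    by rewrite mul0r add0r mulr1.
  have fE s : `|s - 0| < r -> pt ((f \o g) (w + s *: e)) i = pt w i + pt e i * s.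
    by move=> /rP[[_ fgs] _]; rewrite /= fgs !ptE !mxE mulrC.
  have h3 : pt (0 : Cn) i + (0 + - pt e i) = 0.
    apply: (hasder0 (hasderD h1 h2)); exists r => // s sr.
    rewrite !fE ?subrr ?normr0 // !mulr0 !addr0 subrr.
    by rewrite mulNr addrACA !subrr addr0.
  move: h3; rewrite !ptE mxE !add0r => /eqP; rewrite oppr_eq0.
  by move/eqP.
have ea : a = 0 by have := ei ord0; rewrite eE !mxE /= mulr1 mulr0 addr0.
have eb : b = 0 by have := ei (Ordinal n1); rewrite eE !mxE /= mulr1 mulr0 add0r.
by move: ab0; rewrite ea eb eqxx.
Qed.

End Dimension.

(** * Existence of a curve *)

Section Existence.
Variables (R : realType) (n : nat).
Local Notation C := (Cplx R).
Local Notation Cn := 'rV[C]_n.+1.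
Implicit Types (W M V : set Cn) (P : PolT C n.+1 -> Prop).

Lemma submanifold_not_point d M (p : Cn) : complex_submanifold d M -> M p ->
  (0 < d)%N -> exists2 q, M q & q != p.
Proof.
move=> Md Mp d0; pose e : Cn := delta_mx 0 ord0.
have [f [g [w [_ _ gw line]]]] := chart_line Md Mp.
have nb : nbhs (0 : C) [set s : C | M (g (w + s *: e)) /\ f (g (w + s *: e)) = w + s *: e].
  apply: line => i di; rewrite mxE; case: (i =P ord0) => [i0|]; rewrite ?andbF //.
  by move: di; rewrite i0 leqNgt d0.
have [r r0 rP] := nbhs0_radius nb.
have r20 : 0 < r / 2%:R by rewrite divr_gt0.
have [|M1 fg1] := rP (r / 2%:R).
  by rewrite subr0 gtr0_norm // [X in _ < X]splitr ltrDl.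
have [|_ fg0] := rP 0; first by rewrite subrr normr0.
exists (g (w + (r / 2%:R) *: e)) => //; apply/eqP => gp.
have : w + (r / 2%:R) *: e = w + (0 : C) *: e.
  by rewrite -fg1 gp -fg0 scale0r addr0 gw.
move=> /addrI/rowP/(_ ord0); rewrite !mxE /= mul0r mulr1 => /eqP.
by rewrite gt_eqF.
Qed.

Lemma cdim_gt0 (S : set Cn) : (0 < cdim S)%N -> exists d M,
  [/\ (0 < d)%N, complex_submanifold d M, M !=set0 & M `<=` S].
Proof.
rewrite /cdim => h; apply: contrapT => nex; move: h; apply/negP; rewrite -eqn0Ngt -leqn0.
apply/bigmax_leqP => d /asboolP[M [Md M0 MS]]; rewrite leqNgt; apply/negP => d0.
by apply: nex; exists d, M.
Qed.

(** Were the set finite, p would be isolated in V, so V would be {p} by [isolated_zero_only], and no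
    submanifold of positive dimension fits in a point. *)
Lemma irreducible_meets_infinitely V (p : Cn) : irreducible_algebraic V ->
  (0 < cdim V)%N -> V p -> polydisc p ->
  ~ fin_pts n.+1 (fun u => V (rv n.+1 u) /\ in_disc n u).
Proof.
move=> irrV /cdim_gt0[d [M [d0 Md [q Mq] MV]]] Vp Dp [s sP].
have pP := irreducible_prime irrV; have aV : algebraic V by case: irrV.
have Pp : zeros (ideal_of V) (pt p) by apply: zeros_vanish; rewrite ptK.
have single z : V z -> z = p.
  move=> Vz; apply/rowP => i; rewrite -!ptE.
  have Pz : zeros (ideal_of V) (pt z) by apply: zeros_vanish; rewrite ptK.
  apply: (isolated_zero_only pP Pp _ Pz) => //.
  have near_s : forall i, (i < n.+1)%N ->
      nearby n.+1 (pt p) (fun u => u i \in s -> u i = pt p i).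
    move=> j jn; elim: (s) => [|a s' IHs]; first by apply: nearW (near_all _ _) _.
    have [ap|ap] := eqVneq a (pt p j).
      by apply: nearW IHs _ => u h; rewrite in_cons => /orP[/eqP ->|/h].
    have na : 0 < `|a - pt p j| by rewrite normr_gt0 subr_eq0.
    apply: nearW (nearI IHs (cont_proj (pt p) jn na)) _ => u [h ua].
    rewrite in_cons => /orP[/eqP uE|/h //].
    by rewrite uE ltxx in ua.
  have Dpt : in_disc n (pt p) by apply/in_discP.
  apply: nearW (nearI (in_disc_near Dpt) (near_forall near_s)) _ => u [Du us] Pu j jn.
  by apply: us => //; apply: sP => //; split=> //; apply: algebraic_zeros.
have [z Mz] := submanifold_not_point Md Mq d0.
by rewrite (single z (MV _ Mz)) (single q (MV _ Mq)) eqxx.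
Qed.

Definition graph_disc (phi : C -> nat -> C) (a r : C) : set Cn :=
  [set z | `|z 0 ord0 - a| < r /\
     forall i : 'I_n.+1, (1 <= i)%N -> z 0 i = phi (z 0 ord0) i].

Lemma graph_submanifold phi (a r : C) :
  (forall s, `|s - a| < r -> forall i, (i < n.+1)%N ->
     exists d, hasder (fun s => phi s i) s d) ->
  complex_submanifold 1 (graph_disc phi a r).
Proof.
move=> dphi; split=> // p [pr pphi].
(* The entry 0 is set to 0 so that the chart, which subtracts the tail over z_0, and its inverse
   both preserve z_0. *)
pose tail s (i : nat) : C := if i is 0 then 0 else phi s i.
pose U : set Cn := [set z | `|z 0 ord0 - a| < r].
pose f (z : Cn) : Cn := z - rv n.+1 (tail (z 0 ord0)).
pose g (z : Cn) : Cn := z + rv n.+1 (tail (z 0 ord0)).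
have f0 z : f z 0 ord0 = z 0 ord0 by rewrite !mxE subr0.
have g0 z : g z 0 ord0 = z 0 ord0 by rewrite !mxE addr0.
have oU : open U.
  rewrite openE => z Uz.
  have e0 : 0 < r - `|z 0 ord0 - a| by rewrite subr_gt0.
  have := near_nbhs (cont_proj (pt z) (ltn0Sn n) e0).
  apply: (@filterS _ (nbhs z) (nbhs_filter z)) => y.
  rewrite /mkset (ptE _ ord0) (ptE _ ord0) ltrBrDr => /(le_lt_trans _); apply.
  by have := ler_normD (y 0 ord0 - z 0 ord0) (z 0 ord0 - a); rewrite addrA subrK.
have dtail z : U z -> differentiable (fun z : Cn => rv n.+1 (tail (z 0 ord0))) z.
  move=> Uz; apply: (@differentiable_comp _ _ _ _ (fun z : Cn => z 0 ord0) (fun s : C => rv n.+1 (tail s))).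
    exact: differentiable_coord.
  apply: differentiable_row => -[|i] lin; first exact: differentiable_cst.
  by have [d hd] := dphi _ Uz _ lin; apply: hasder_derivable hd.
have fg z : f (g z) = z by rewrite /f g0 addrK.
have gf z : g (f z) = z by rewrite /g f0 subrK.
exists U, U, f, g; split; first exact: pr.
  split.
  - split; first exact: oU.
    move=> z Uz; apply: differentiableB; [by []|exact: dtail].
  - split; first exact: oU.
    move=> z Uz; apply: differentiableD; [by []|exact: dtail].
  - apply/seteqP; split=> [_ [z Uz <-]|z Uz]; first by rewrite /U /mkset f0.
    by exists (g z); rewrite ?fg // /U /mkset g0.
  - by move=> z _; exact: gf.
move=> z Uz; split=> [[_ zphi] i i1|zf].
  by rewrite !mxE (zphi i i1) /tail; case: (val i) i1 => // j _; rewrite subrr.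
split=> // i i1; apply/eqP; rewrite -subr_eq0; apply/eqP.
by have := zf i i1; rewrite !mxE /tail; case: (val i) i1.
Qed.

(** V has an infinite part in the polydisc whose ideal P is prime. A free z_k with k > 0 contradicts
    the finiteness of the slices of W, a point contradicts infinity, and the remaining curve is a
    graph over a disc in z_0. *)
Lemma exists_curve W V : algebraic W ->
  W `&` @bd_polydisc R n.+1 = W `&` @torus R n.+1 ->
  irreducible_component V W -> (0 < cdim V)%N -> V `&` @polydisc R n.+1 !=set0 ->
  exists M, [/\ complex_submanifold 1 M, M !=set0 & M `<=` W `&` @polydisc R n.+1].
Proof.
move=> aW bdW [irrV VW _] V0 [p [Vp Dp]].
have aV : algebraic V by case: irrV.
have [S0 [nS0 S0S pP _]] := infinite_prime (irreducible_meets_infinitely irrV V0 Vp Dp).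
set P := vanish S0 in pP.
have VP h : ideal_of V h -> P h.
  by move=> Vh u /S0S[Vu _]; rewrite -ev_rv (proj1 (ideal_ofP _ _) Vh).
have [c Pc cP] := local_structure pP.
have [q [Sq cq]] : exists q, S0 q /\ ev n.+1 q c != 0.
  apply: contrapT => h; apply: Pc => u Su; apply/eqP; apply: contrapT => /negP cu.
  by apply: h; exists u.
have [_ Dq] := S0S q Sq; have Pq : zeros P q by apply: zeros_vanish.
case: cP => [[k kn lP]|[_ [/zeros_point[a aP]|curve]]].
- case: (no_lift aW bdW _ kn lP Pq cq Dq) => h /ideal_ofP Wh.
  by apply: VP; apply/ideal_ofP => z /VW/Wh.
- case: nS0; exists [seq a i | i <- iota 0 n.+1] => z /zeros_vanish/aP za i lin.
  by rewrite za //; apply/mapP; exists i => //; rewrite mem_iota.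
have [e e0 eD] := in_disc_near Dq.
have [r [phi [r0 phiP]]] := curve q Pq cq e e0.
have graphE z : graph_disc phi (q 0%N) r z -> z = rv n.+1 (phi (z 0 ord0)).
  move=> [zr zphi]; apply/rowP => i; rewrite mxE.
  have [i0|i1] := posnP i; last exact: zphi.
  have -> : i = ord0 by apply: val_inj.
  by have [-> _ _ _] := phiP _ zr.
exists (graph_disc phi (q 0%N) r); split.
- by apply: graph_submanifold => s /phiP[].
- exists (rv n.+1 (phi (q 0%N))).
  have qr : `|q 0%N - q 0%N| < r by rewrite subrr normr0.
  have [phi0 _ _ _] := phiP _ qr.
  by split=> [|i _]; rewrite !mxE phi0.
move=> z Gz; have [zr _] := Gz; have [_ Pphi phiq _] := phiP _ zr.
rewrite (graphE z Gz); split.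
  by apply/VW/(algebraic_zeros aV) => h /VP/Pphi.
apply/in_discP => i lin; rewrite rvK //; exact: eD.
Qed.

End Existence.

Theorem corollary3p7 (R : realType) (n : nat) (hn : (2 <= n)%N)
    (Omega : set 'rV[Cplx R]_n) (hOmega : distinguished Omega) :
  cdim Omega = 1%N.
Proof.
case: n hn Omega hOmega => // n hn Omega [W [aW [V [VW V0 VD]] bdW ->]].
apply/eqP; rewrite eqn_leq; apply/andP; split.
  apply/bigmax_leqP => d /asboolP[M [Md M0 MW]].
  exact: submanifold_dim_le1 aW bdW Md M0 MW.
have [M [M1 M0 MW]] := exists_curve aW bdW VW V0 VD.
have n2 : (1 < n.+2)%N by [].
apply: (leq_trans _ (@leq_bigmax_cond _ _ (fun d : 'I_n.+2 => val d) (Ordinal n2) _)) => //.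
by apply/asboolP; exists M.
Qed.
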